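(* The polynomial $$p_t(K)=\begin{cases}\sum_d \mathrm{sgn}(d)\,(t^{|i(d)|}-1)&\text{in the unframed case}\\ \sum_d \mathrm{sgn}(d)\,t^{|i(d)|}&\text{in the framed case}\end{cases}$$ in $\mathbb{Z}[t]$ (sums over all classical crossings $d$ of $K$) is a Vassiliev invariant of order one of long virtual knots, both in the framed and in the unframed category.
   Context: A long virtual knot diagram is an immersion $\mathbb{R}\to\mathbb{R}^2$ which coincides with the $x$-axis outside some closed ball centered at the origin and whose double points are decorated either as classical crossings (with over/under information, hence a sign $\mathrm{sgn}=\pm1$) or as virtual crossings. Long virtual knots (unframed) are diagrams modulo the classical Reidemeister moves 1, 2, 3, the purely virtual Reidemeister moves 1, 2, 3, and the mixed move (sliding an arc carrying only virtual crossings past a classical crossing). Framed long virtual knots are defined in the same way, except that classical Reidemeister move 1 is replaced by the framed Reidemeister move 1, which inserts or removes on an arc two consecutive kinks whose classical crossings have opposite signs. For a classical crossing $d$ of $K$, smooth $d$ according to orientation to obtain a two-component virtual tangle (one long component and one closed component), and forget the over/under information. Choose an ordering $\{1,2\}$ of the two components. For a classical crossing $x$ between the two components ($x\in1\cap2$) let $\mathrm{sgn}(x)=+1$ if the tangent vectors at $x$ (of component 1, of component 2), in this order, form a positively oriented basis of the plane, and $-1$ otherwise. The intersection index is $i(d)=\sum_{x\in1\cap2}\mathrm{sgn}(x)$; changing the ordering changes only its sign, so $|i(d)|$ is well defined. A knot invariant $\nu$ with values in an abelian group is extended to singular long virtual knots (with transverse double points, up to the classical Reidemeister moves 2, 3,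 the purely virtual Reidemeister moves 1, 2, 3, the mixed move, the classical Reidemeister move 1 in the unframed category or the framed Reidemeister move 1 in the framed category, and rigid vertex isotopy) by $\nu(K_\bullet)=\nu(K_+)-\nu(K_-)$, where $K_\pm$ replace a double point by a positive/negative crossing. It is a Vassiliev (finite-type) invariant of order $\le n$ if it vanishes on all knots with more than $n$ double points; it has order one if it has order $\le1$ but is not of order $\le0$, i.e. it is nonzero on some knot with exactly one double point. *)

(* Defs.v *)
(* MathComp-Analysis; R is an arbitrary realType. *)
From HB Require Import structures.
From Stdlib Require Relation_Operators.
From mathcomp Require Import all_boot all_order all_algebra.
From mathcomp Require Import finmap.
From mathcomp Require Import all_classical all_reals all_analysis.

Set Implicit Arguments.
Unset Strict Implicit.
Unset Printing Implicit Defensive.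

Import Order.TTheory GRing.Theory Num.Theory.
Import numFieldNormedType.Exports.

Local Open Scope classical_set_scope.
Local Open Scope ring_scope.

Section Plane.
Variable R : realType.
Implicit Types (u v p q c : R * R) (r : R).

Definition det2 u v : R := u.1 * v.2 - u.2 * v.1.

(* Euclidean: the norm of the normed module R * R is the sup norm. *)
Definition sqdist p q : R := (p.1 - q.1) ^+ 2 + (p.2 - q.2) ^+ 2.

Definition closed_disc c r : set (R * R) := [set p | sqdist p c <= r ^+ 2].
Definition open_disc c r : set (R * R) := [set p | sqdist p c < r ^+ 2].
Definition circle c r : set (R * R) := [set p | sqdist p c = r ^+ 2].

(* Orientation-preserving C^1 diffeomorphisms of the plane with compact support;
   they are exactly the end maps of compactly supported ambient isotopies.
   The inverse is C^1 by the inverse function theorem. *)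
Definition plane_diffeo (phi : R * R -> R * R) : Prop :=
  [/\ bijective phi,
      forall p, differentiable phi p,
      forall v, continuous (fun p => 'D_v phi p),
      forall p, 0 < det2 ('D_(1, 0) phi p) ('D_(0, 1) phi p)
    & exists r, forall p, ~ closed_disc 0 r p -> phi p = p].

Definition line_diffeo (h : R -> R) : Prop :=
  [/\ forall t, derivable h t 1,
      continuous (derive1 h),
      forall t, 0 < derive1 h t
    & exists r, forall t, r <= `|t| -> h t = t].

(* The velocity, computed componentwise. *)
Definition tangent (gamma : R -> R * R) (t : R) : R * R :=
  (derive1 (fun s => (gamma s).1) t, derive1 (fun s => (gamma s).2) t).

Definition c1_immersion (gamma : R -> R * R) : Prop :=
  [/\ forall t, derivable (fun s => (gamma s).1) t 1 /\
                derivable (fun s => (gamma s).2) t 1,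
      continuous (derive1 (fun s => (gamma s).1)),
      continuous (derive1 (fun s => (gamma s).2))
    & forall t, tangent gamma t != (0, 0)].

Definition self_meets (gamma : R -> R * R) (s t : R) : Prop :=
  s != t /\ gamma s = gamma t.

Definition generic (gamma : R -> R * R) : Prop :=
  [/\ forall s t, self_meets gamma s t ->
        det2 (tangent gamma s) (tangent gamma t) != 0,
      forall s t (w : R), self_meets gamma s t -> self_meets gamma t w -> s = w
    & finite_set [set x : R * R | x.1 < x.2 /\ gamma x.1 = gamma x.2]].

End Plane.

(* How the strand at one preimage of a double point appears relative to the
   strand at the other preimage. *)
Inductive kind := Over | Under | Virtual | Singular.

Definition flip (k : kind) : kind :=
  match k with
  | Over => Under | Under => Over | Virtual => Virtual | Singular => Singular
  end.

Definition classical (k : kind) : bool :=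
  match k with Over | Under => true | Virtual | Singular => false end.

(* Possibly singular long virtual knot diagrams; [mark s t] is meaningful only
   when the curve meets itself at the parameters s and t. *)
Record diagram (R : realType) := Diagram {
  curve :> R -> R * R;
  mark : R -> R -> kind;
  curve_immersion : c1_immersion curve;
  curve_long : exists r : R, forall t, r <= `|t| -> curve t = (t, 0);
  curve_generic : generic curve;
  mark_flip : forall s t, self_meets curve s t -> mark t s = flip (mark s t) }.

Section Crossings.
Variable R : realType.
Implicit Types (D : diagram R) (s t : R) (k : kind).

(* A double point is represented by its two parameters in increasing order. *)
Definition double_points D : set (R * R) :=
  [set d | d.1 < d.2 /\ D d.1 = D d.2].
Definition classical_crossings D : set (R * R) :=
  [set d | double_points D d /\ classical (mark D d.1 d.2)].
Definition singular_points D : set (R * R) :=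
  [set d | double_points D d /\ mark D d.1 d.2 = Singular].

Definition num_singular D : nat := #|` fset_set (singular_points D)|.
Definition nonsingular D : Prop := singular_points D = set0.

(* +1 when (first tangent, second tangent) is a positive basis. *)
Definition flat_sign D s t : int := sgz (det2 (tangent D s) (tangent D t)).

(* The usual sign of a crossing: +1 when (over, under) is a positive basis. *)
Definition sgn D s t : int :=
  match mark D s t with
  | Over => flat_sign D s t
  | Under => flat_sign D t s
  | Virtual | Singular => 0
  end.

(* Smoothing the crossing d = (s, t) cuts off the closed component traced by
   ]s, t[; the long component is traced by the parameters outside [s, t]. *)
Definition on_closed (d : R * R) (u : R) : bool := d.1 < u < d.2.

(* The endpoints of d never satisfy [on_closed d], so d itself is excluded. *)
Definition mixed_crossings D (d : R * R) : set (R * R) :=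
  [set x | classical_crossings D x /\ on_closed d x.1 != on_closed d x.2].

(* Component 1 is the long one, component 2 the closed one. *)
Definition intersection_index D (d : R * R) : int :=
  \sum_(x \in mixed_crossings D d)
     (if on_closed d x.1 then flat_sign D x.2 x.1 else flat_sign D x.1 x.2).

Fact set_mark_flip D s t k u v : self_meets D u v ->
  let m a b := if (a, b) == (s, t) then k
               else if (a, b) == (t, s) then flip k else mark D a b in
  m v u = flip (m u v).
Proof.
move=> uv /=; have [neq_uv _] := uv.
rewrite !xpair_eqE.
have [us|us] := eqVneq u s; have [vt|vt] := eqVneq v t;
  have [vs|vs] := eqVneq v s; have [ut|ut] := eqVneq u t => //=;
  rewrite ?(mark_flip uv) //; try by case: (k).
all: by move: neq_uv; rewrite ?us ?vs ?ut ?vt ?eqxx // -?us -?vs -?ut -?vt ?eqxx.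
Qed.

Definition set_mark D s t k : diagram R :=
  Diagram (curve_immersion D) (curve_long D) (curve_generic D)
    (@set_mark_flip D s t k).

(* Replace the double point with parameters s and t by a classical crossing,
   positive if b is true and negative otherwise. *)
Definition resolve (b : bool) D s t : diagram R :=
  set_mark D s t
    (if (0 < det2 (tangent D s) (tangent D t)) == b then Over else Under).

End Crossings.

Section Moves.
Variable R : realType.
Implicit Types (D : diagram R) (I J m : R * R) (c : R * R) (r : R).

(* Planar isotopy and reparametrization. *)
Definition isotopic D D' : Prop :=
  exists (phi : R * R -> R * R) (h : R -> R),
    [/\ plane_diffeo phi, line_diffeo h,
        forall t, D' t = phi (D (h t))
      & forall s t, self_meets D' s t -> mark D' s t = mark D (h s) (h t)].

Definition on_arc I (t : R) : bool := I.1 < t < I.2.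

(* The part of D in the closed disc consists of proper arcs, parametrized by
   disjoint intervals, whose endpoints are distinct points of the circle. *)
Definition tangle_in D c r (arcs : seq (R * R)) : Prop :=
  [/\ 0 < r,
      all (fun I => I.1 < I.2) arcs &
      pairwise (fun I J => (I.2 < J.1) || (J.2 < I.1)) arcs] /\
  [/\ forall t, closed_disc c r (D t) <-> exists2 I, I \in arcs & I.1 <= t <= I.2,
      forall t, open_disc c r (D t) <-> exists2 I, I \in arcs & on_arc I t
    & forall s t, self_meets D s t -> ~ circle c r (D s)].

Definition straight D I : Prop :=
  exists p v : R * R, forall t, I.1 <= t <= I.2 -> D t = p + t *: v.

(* Inside the disc, D and D' consist of common straight chords and of one more
   arc, parametrized by m, which is the only part of the curve that may differ.
   Up to planar isotopy every Reidemeister move has this form. *)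
Definition local_change D D' c r m (chords : seq (R * R)) : Prop :=
  [/\ tangle_in D c r (m :: chords),
      tangle_in D' c r (m :: chords),
      forall I, I \in chords -> straight D I,
      forall t, ~~ on_arc m t -> D t = D' t
    & forall s t, self_meets D s t -> ~~ on_arc m s -> ~~ on_arc m t ->
        mark D s t = mark D' s t].

Definition self_crossings D I (xs : seq (R * R)) : Prop :=
  forall s t, [/\ on_arc I s, on_arc I t, s < t & D s = D t] <-> (s, t) \in xs.

(* For disjoint arcs; the first parameter runs over I, the second over J. *)
Definition crossings_between D I J (xs : seq (R * R)) : Prop :=
  forall s t, [/\ on_arc I s, on_arc J t & D s = D t] <-> (s, t) \in xs.

(* D has one kink, D' has none. *)
Definition kink_move (ok : pred kind) D D' : Prop :=
  exists c r m s t,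
    [/\ local_change D D' c r m [::],
        self_crossings D m [:: (s, t)],
        self_crossings D' m [::]
      & ok (mark D s t)].

(* D has two consecutive kinks with opposite signs, D' has none. *)
Definition double_kink_move D D' : Prop :=
  exists c r m s1 t1 s2 t2,
    [/\ local_change D D' c r m [::],
        self_crossings D m [:: (s1, t1); (s2, t2)],
        self_crossings D' m [::] &
        t1 < s2] /\
    [/\ classical (mark D s1 t1), classical (mark D s2 t2)
      & sgn D s1 t1 = - sgn D s2 t2].

(* The moving arc is pushed off a chord with which it bounds a bigon. *)
Definition bigon_move (ok : pred kind) D D' : Prop :=
  exists c r m I s1 t1 s2 t2,
    [/\ local_change D D' c r m [:: I],
        self_crossings D m [::] /\ self_crossings D' m [::],
        s1 < s2 /\ crossings_between D m I [:: (s1, t1); (s2, t2)],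
        crossings_between D' m I [::]
      & mark D s1 t1 = mark D s2 t2 /\ ok (mark D s1 t1)].

(* The moving arc, which passes both chords in the same way k, slides past their
   intersection point, of kind l. For a move with three classical crossings the
   moving arc can be taken to be the topmost or the bottommost of the three. *)
Definition triangle_move (ok : kind -> kind -> bool) D D' : Prop :=
  exists c r m I J u v x y x' y' k,
    [/\ local_change D D' c r m [:: I; J],
        self_crossings D m [::] /\ self_crossings D' m [::],
        crossings_between D I J [:: (u, v)],
        crossings_between D m I [:: x] /\ crossings_between D m J [:: y] &
        crossings_between D' m I [:: x'] /\ crossings_between D' m J [:: y']] /\
    [/\ mark D x.1 x.2 = k /\ mark D y.1 y.2 = k,
        mark D' x'.1 x'.2 = k /\ mark D' y'.1 y'.2 = k
      & ok k (mark D u v)].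

(* Half turn of a rigid vertex: in a bigon with one singular and one classical
   vertex these are exchanged. The crossing keeps its sign; as the flat signs at
   the two vertices are opposite, over and under are swapped. *)
Definition vertex_twist D D' : Prop :=
  exists c r m I s1 t1 s2 t2,
    [/\ forall t, D t = D' t,
        tangle_in D c r [:: m; I] /\ straight D I,
        self_crossings D m [::],
        crossings_between D m I [:: (s1, t1); (s2, t2)] &
        forall s t, self_meets D s t -> ~ closed_disc c r (D s) ->
          mark D s t = mark D' s t] /\
    [/\ mark D s1 t1 = Singular,
        classical (mark D s2 t2),
        mark D' s1 t1 = flip (mark D s2 t2)
      & mark D' s2 t2 = Singular].

Definition virtual (k : kind) : bool := if k is Virtual then true else false.
Definition singular (k : kind) : bool := if k is Singular then true else false.

Inductive framing := Unframed | Framed.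

Inductive move (f : framing) : diagram R -> diagram R -> Prop :=
| PlanarIsotopy D D' : isotopic D D' -> move f D D'
| Classical1 D D' : f = Unframed -> kink_move classical D D' -> move f D D'
| Framed1 D D' : f = Framed -> double_kink_move D D' -> move f D D'
| Classical2 D D' : bigon_move classical D D' -> move f D D'
| Classical3 D D' :
    triangle_move (fun k l => classical k && classical l) D D' -> move f D D'
| Virtual1 D D' : kink_move virtual D D' -> move f D D'
| Virtual2 D D' : bigon_move virtual D D' -> move f D D'
| Virtual3 D D' :
    triangle_move (fun k l => virtual k && virtual l) D D' -> move f D D'
| Mixed D D' :
    triangle_move (fun k l => virtual k && classical l) D D' -> move f D D'
| RigidVertexSlide D D' :
    triangle_move (fun k l => (classical k || virtual k) && singular l) D D' ->
    move f D D'
| RigidVertexTwist D D' : vertex_twist D D' -> move f D D'.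

(* Singular knots are the classes of this relation. No move changes the number
   of singular points, so on nonsingular diagrams this is the equivalence that
   defines (framed) long virtual knots. *)
Definition equivalent (f : framing) : diagram R -> diagram R -> Prop :=
  Relation_Operators.clos_refl_sym_trans _ (move f).

End Moves.

Section Vassiliev.
Variables (R : realType) (f : framing) (A : zmodType).
Implicit Types (nu : diagram R -> A) (n : nat).

(* An invariant of possibly singular knots which is the extension of nu. The
   values of nu on diagrams with singular points are irrelevant. *)
Definition singular_extension nu nu' : Prop :=
  [/\ forall D D', equivalent f D D' -> nu' D = nu' D',
      forall D, nonsingular D -> nu' D = nu D
    & forall D d, singular_points D d ->
        nu' D = nu' (resolve true D d.1 d.2) - nu' (resolve false D d.1 d.2)].

Definition vassiliev_order_le nu n : Prop :=
  exists2 nu', singular_extension nu nu' &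
    forall D, (n < num_singular D)%N -> nu' D = 0.

Definition vassiliev_order_one nu : Prop :=
  vassiliev_order_le nu 1 /\ ~ vassiliev_order_le nu 0.

End Vassiliev.

Definition index_polynomial (R : realType) (f : framing) (D : diagram R) :
    {poly int} :=
  \sum_(d \in classical_crossings D)
     sgn D d.1 d.2 *: (let i := absz (intersection_index D d) in
                       match f with
                       | Unframed => 'X^i - 1
                       | Framed => 'X^i
                       end).

(* Main.v *)
(* Summing, over all classical crossings x with parameters x1, x2, the flat sign of
   x times the linking number of {x1, x2} and {d1, d2} on the line gives twice the
   index of d, up to sign, whichever way the parameters of x and d are ordered.

   Resolving a double point changes no index and changes only the sign of that
   point, by 2. Hence the extension to a knot with exactly one double point d is
   2 (t^|i(d)| - 1), respectively 2 t^|i(d)|, and it vanishes on knots with more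
   double points. It remains to see that this extension is invariant.

   A Reidemeister move changes the curve inside a disc only. Crossings outside the
   disc keep their indices if the contributions of the crossings inside balance:
   the two endpoints of a kink are adjacent; the two flat signs of a bigon are
   opposite, since the moving arc enters and leaves a half plane; and in a triangle
   the position of each crossing along the two chords is determined by the side of
   the other chord on which the moving arc runs, so that the order along the three
   arcs affects each index by two terms which cancel.

   Order exactly one is witnessed by a trefoil with one singular, one classical and
   one virtual double point, in which the singular point has index 1 or -1. *)
Require Import Defs.
From Stdlib Require Relation_Operators.
From mathcomp Require Import all_boot all_order all_algebra finmap.
From mathcomp Require Import all_classical all_reals all_analysis.
From mathcomp Require Import ring lra zify.

Set Implicit Arguments.
Unset Strict Implicit.
Unset Printing Implicit Defensive.

Import Order.TTheory GRing.Theory Num.Theory.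
Import numFieldNormedType.Exports.

Local Open Scope classical_set_scope.
Local Open Scope ring_scope.

(** * Enumerating double points *)

Section Listings.
Variable R : realType.
Implicit Types (D : diagram R) (xs ys : seq (R * R)).

Lemma self_meets_sym D s t : self_meets D s t -> self_meets D t s.
Proof. by case=> neq eq; split; rewrite // eq_sym. Qed.

(* Each double point is listed once, with its parameters in either order. *)
Definition listing D xs :=
  [/\ uniq xs, forall x, x \in xs -> self_meets D x.1 x.2,
      forall x, x \in xs -> (x.2, x.1) \notin xs
    & forall s t, self_meets D s t -> ((s, t) \in xs) || ((t, s) \in xs)].

Definition sort_pair (x : R * R) := if x.1 < x.2 then x else (x.2, x.1).

(** Sorting each pair turns any listing into a permutation of the increasing double points. A
    summand symmetric in the two parameters can therefore be summed over whichever listing suits the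
    move at hand. *)
Lemma listing_sum (V : nmodType) D xs ys (g : R * R -> V) :
  (forall s t, self_meets D s t -> g (s, t) = g (t, s)) ->
  listing D xs -> listing D ys ->
  \sum_(x <- xs) g x = \sum_(y <- ys) g y.
Proof.
move=> gC Hxs Hys.
have sortE zs : listing D zs ->
    \sum_(x <- zs) g x = \sum_(x <- map sort_pair zs) g x.
  case=> _ meets _ _; rewrite big_map; apply: eq_big_seq => -[s t] /meets st.
  by rewrite /sort_pair /=; case: ifP => // _; apply: gC.
have sort_uniq zs : listing D zs -> uniq (map sort_pair zs).
  case=> uzs meets anti _; rewrite map_inj_in_uniq // => -[a b] [c d] ab cd.
  rewrite /sort_pair /=; case: ifP => ltab; case: ifP => ltcd [] ? ?; subst => //.
  - by have := anti _ ab; rewrite cd.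
  - by have := anti _ ab; rewrite cd.
have mem_sort zs : listing D zs -> forall a b,
    ((a, b) \in map sort_pair zs) <-> a < b /\ self_meets D a b.
  case=> _ meets _ cover a b; split.
    case/mapP=> -[c d] cd; have := meets _ cd; rewrite /sort_pair /= => mcd.
    case: ifP => ltcd [-> ->]; split=> //; last exact: self_meets_sym.
    by case: mcd => ncd _; rewrite lt_neqAle eq_sym ncd leNgt ltcd.
  case=> ltab /cover /orP[] H; apply/mapP; [exists (a, b)|exists (b, a)] => //.
    by rewrite /sort_pair /= ltab.
  by rewrite /sort_pair /= ltNge ltW.
rewrite (sortE _ Hxs) (sortE _ Hys); apply: perm_big.
apply: uniq_perm; [exact: sort_uniq|exact: sort_uniq|].
by move=> [a b]; apply/idP/idP => /mem_sort H; apply/mem_sort => //; apply: H.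
Qed.

Definition dps D : seq (R * R) := fset_set (double_points D).

Lemma finite_double_points D : finite_set (double_points D).
Proof. by case: (curve_generic D). Qed.

Lemma mem_dps D x : (x \in dps D) = (x.1 < x.2) && (D x.1 == D x.2).
Proof.
rewrite /dps in_fset_set; last exact: finite_double_points.
by apply/idP/idP => [/set_mem[-> /eqP->]//|/andP[lt /eqP eq]]; apply/mem_set.
Qed.

Lemma listing_dps D : listing D (dps D).
Proof.
split; first exact: fset_uniq.
- by move=> x; rewrite mem_dps => /andP[lt /eqP eq]; split; rewrite // lt_eqF.
- by move=> x; rewrite !mem_dps /= => /andP[lt _]; rewrite ltNge ltW.
- move=> s t [neq eq]; rewrite !mem_dps /= eq eqxx !andbT.
  by rewrite lt_neqAle (lt_neqAle t) neq eq_sym neq /= le_total.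
Qed.

Lemma fsum_dps (V : zmodType) D (A : set (R * R)) (P : pred (R * R)) (g : R * R -> V) :
  (forall x, A x <-> double_points D x /\ P x) ->
  \sum_(x \in A) g x = \sum_(x <- dps D | P x) g x.
Proof.
move=> AE; rewrite -[RHS]big_filter [RHS]fsbig_seq; last by rewrite filter_uniq // fset_uniq.
apply: eq_fsbigl; apply/seteqP; split=> x /=; rewrite mem_filter mem_dps.
  by move=> /AE[[-> ->] ->]; rewrite eqxx.
by move=> /and3P[Px lt /eqP eq]; apply/AE.
Qed.

Lemma singular_dps D :
  num_singular D = count (fun x => singular (mark D x.1 x.2)) (dps D).
Proof.
rewrite -size_filter; apply: perm_size; apply: uniq_perm.
- exact: fset_uniq.
- by rewrite filter_uniq // fset_uniq.
move=> x; rewrite mem_filter mem_dps in_fset_set; last first.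
  by apply: sub_finite_set (finite_double_points D) => y [].
apply/idP/idP => [/set_mem[[/= -> -> ->]]|]; first by rewrite eqxx.
case/and3P=> sg lt /eqP eq; apply/mem_set; split; first by split.
by case: (mark _ _ _) sg.
Qed.

Lemma singular_listing D xs : listing D xs ->
  num_singular D = count (fun x => singular (mark D x.1 x.2)) xs.
Proof.
move=> Hxs; rewrite singular_dps -!sumn_count !sumnE !big_map.
apply: (listing_sum _ (listing_dps D) Hxs) => s t st /=.
by rewrite (mark_flip st); case: (mark D s t).
Qed.

End Listings.

(** * The index as a sum of linking numbers on the line *)

Section Index.
Variable R : realType.
Implicit Types (D : diagram R) (x y : R * R).

(** The value 0 at virtual and singular points removes them from every index. At a double point
    [charge] is antisymmetric in the two parameters, like [linking], so the product of the two is
    symmetric. *)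
Definition charge D x : int :=
  if classical (mark D x.1 x.2) then flat_sign D x.1 x.2 else 0.

(* For disjoint increasing pairs, 2 or -2 if exactly one entry of x lies between
   those of y, and 0 otherwise. *)
Definition linking x y : int :=
  sgz (y.1 - x.1) - sgz (y.1 - x.2) - sgz (y.2 - x.1) + sgz (y.2 - x.2).

Definition double_index D y : int :=
  \sum_(x <- dps D) charge D x * linking x y.

Lemma flat_signC D s t : flat_sign D t s = - flat_sign D s t.
Proof. by rewrite /flat_sign -sgzN; congr sgz; rewrite /det2; ring. Qed.

Lemma chargeC D s t : self_meets D s t -> charge D (t, s) = - charge D (s, t).
Proof.
move=> st; rewrite /charge /= (mark_flip st) flat_signC.
by case: (mark D s t); rewrite /= ?oppr0.
Qed.

Lemma sgnC D s t : self_meets D s t -> sgn D t s = sgn D s t.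
Proof. by move=> st; rewrite /sgn (mark_flip st); case: (mark D s t). Qed.

Lemma linkingCl x y : linking (x.2, x.1) y = - linking x y.
Proof. by rewrite /linking /=; ring. Qed.

Lemma linkingCr x y : linking x (y.2, y.1) = - linking x y.
Proof. by rewrite /linking /=; ring. Qed.

Lemma linkingxx x : linking x x = 0.
Proof. by rewrite /linking !subrr -(opprB x.2 x.1) !sgzN sgz0; ring. Qed.

Lemma double_index_listing D xs y : listing D xs ->
  double_index D y = \sum_(x <- xs) charge D x * linking x y.
Proof.
move=> Hxs; apply: (listing_sum _ (listing_dps D) Hxs) => s t st.
by rewrite (chargeC st) (linkingCl (s, t)) mulrNN.
Qed.

Lemma double_indexC D y : double_index D (y.2, y.1) = - double_index D y.
Proof.
by rewrite /double_index -sumrN; apply: eq_bigr => x _; rewrite linkingCr mulrN.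
Qed.

Lemma sgz_mid (a b r : R) : a < b -> r != a -> r != b ->
  sgz (a - r) - sgz (b - r) = if a < r < b then - 2%:Z else 0.
Proof.
move=> ab ra rb; case: (ltrgtP a r) ra => // ar _ /=; last first.
  by rewrite !gtr0_sgz ?subr_gt0 // (lt_trans ar).
rewrite (ltr0_sgz (x := a - r)) ?subr_lt0 //.
by case: (ltrgtP r b) rb => // br _;
  [rewrite gtr0_sgz ?subr_gt0 | rewrite ltr0_sgz ?subr_lt0].
Qed.

(** A parameter has at most one partner, so two pairs with a common parameter are equal or reversed,
    and increasing pairs are never reversed. *)
Lemma dps_disjoint D x y : x \in dps D -> y \in dps D -> x != y ->
  [/\ x.1 != y.1, x.1 != y.2, x.2 != y.1 & x.2 != y.2].
Proof.
rewrite !mem_dps => /andP[ltx /eqP eqx] /andP[lty /eqP eqy] nxy.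
have [_ triple _] := curve_generic D.
have mx : self_meets D x.1 x.2 by split; rewrite ?lt_eqF.
have my : self_meets D y.1 y.2 by split; rewrite ?lt_eqF.
have mx' := self_meets_sym mx; have my' := self_meets_sym my.
case: x y => [a b] [c d] /= in ltx lty eqx eqy nxy mx my mx' my' *.
split; apply/eqP => E; subst.
- by rewrite (triple _ _ _ mx' my) eqxx in nxy.
- by move: ltx; rewrite (triple _ _ _ mx' my') ltNge ltW.
- by move: ltx; rewrite (triple _ _ _ mx my) ltNge ltW.
- by rewrite (triple _ _ _ mx my') eqxx in nxy.
Qed.

Lemma double_indexE D y : y \in dps D ->
  `|double_index D y|%N = (2 * `|intersection_index D y|)%N.
Proof.
move=> yD; rewrite -[2%N]/`|2%:Z|%N -abszM; congr absz.
rewrite /intersection_index (@fsum_dps _ _ D _ (fun x =>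
  classical (mark D x.1 x.2) && (on_closed y x.1 != on_closed y x.2))); last first.
  by move=> x; split=> [[[dx cx] ox]|[dx /andP[cx ox]]];
    [split=> //; rewrite cx|split].
rewrite big_mkcond mulr_sumr; apply: eq_big_seq => x xD.
have [->|nxy] := eqVneq x y; first by rewrite linkingxx /on_closed !ltxx !andbF mulr0.
have [n11 n12 n21 n22] := dps_disjoint xD yD nxy.
have lty : y.1 < y.2 by move: yD; rewrite mem_dps => /andP[].
(* Grouped this way, each bracket is -2 or 0 according to whether that parameter of [x] lies on the
   closed component. A mixed crossing thus counts twice, with the flat sign that takes the long
   component first. *)
have -> : linking x y = (sgz (y.1 - x.1) - sgz (y.2 - x.1))
                      - (sgz (y.1 - x.2) - sgz (y.2 - x.2)).
  by rewrite /linking; ring.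
rewrite !sgz_mid // /charge -!/(on_closed y _) (flat_signC D x.1 x.2).
by case: classical => /=; do 2 case: on_closed => //=; ring.
Qed.

End Index.

(** * The extension of the polynomial to singular diagrams *)

Section Extension.
Variables (R : realType) (f : framing).
Implicit Types (D : diagram R) (x y : R * R).

(** [k] stands for the absolute value of twice an index, hence the halving. *)
Definition index_term (k : nat) : {poly int} :=
  match f with Unframed => 'X^(k./2) - 1 | Framed => 'X^(k./2) end.

(** [n] is the number of singular points of the whole diagram. The 2 is the difference of the signs
    of the two resolutions. *)
Definition weight (n : nat) D x : int :=
  match n with
  | 0 => sgn D x.1 x.2
  | 1 => if singular (mark D x.1 x.2) then 2 else 0
  | _ => 0
  end.

(* The values on singular knots are forced by the skein relation: resolving a
   double point does not change its index, and changes its sign by 2. *)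
Definition index_extension D : {poly int} :=
  \sum_(x <- dps D)
    weight (num_singular D) D x *: index_term `|double_index D x|%N.

Lemma weightC n D s t : self_meets D s t -> weight n D (t, s) = weight n D (s, t).
Proof.
move=> st; case: n => [|[|n]] //=; first exact: sgnC.
by rewrite (mark_flip st); case: (mark D s t).
Qed.

Lemma index_extension_listing D xs : listing D xs ->
  index_extension D = \sum_(x <- xs)
    weight (num_singular D) D x *:
      index_term (absz (\sum_(z <- xs) charge D z * linking z x)).
Proof.
move=> Hxs; rewrite /index_extension (listing_sum _ (listing_dps D) Hxs).
  by apply: eq_bigr => x _; rewrite (double_index_listing _ Hxs).
by move=> s t st; rewrite (double_indexC D (s, t)) abszN (weightC _ st).
Qed.

Lemma index_extension_nonsingular D :
  nonsingular D -> index_extension D = index_polynomial f D.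
Proof.
move=> nsD; have n0 : num_singular D = 0%N by rewrite /num_singular nsD fset_set0.
rewrite /index_extension n0 /index_polynomial.
rewrite (@fsum_dps _ _ D _ (fun x => classical (mark D x.1 x.2))) //.
rewrite [RHS]big_mkcond.
apply: eq_big_seq => x xD; rewrite double_indexE // /index_term mul2n doubleK /=.
by rewrite /sgn; case: mark => //=; rewrite scale0r.
Qed.

(** [O] lists the double points common to both diagrams, [L] and [L'] those affected by the move.
    Outer indices are compared only where the weight is nonzero: a vertex twist may change the
    others. *)
Lemma local_invariance D D' (L L' O : seq (R * R)) :
  listing D (L ++ O) -> listing D' (L' ++ O) ->
  (forall x, x \in O -> mark D x.1 x.2 = mark D' x.1 x.2 /\
                        flat_sign D x.1 x.2 = flat_sign D' x.1 x.2) ->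
  count (fun x => singular (mark D x.1 x.2)) L =
    count (fun x => singular (mark D' x.1 x.2)) L' ->
  (forall y, y \in O -> weight (num_singular D) D y != 0 ->
     \sum_(x <- L) charge D x * linking x y =
     \sum_(x <- L') charge D' x * linking x y) ->
  \sum_(y <- L) weight (num_singular D) D y *:
     index_term (absz (\sum_(x <- L ++ O) charge D x * linking x y)) =
  \sum_(y <- L') weight (num_singular D) D' y *:
     index_term (absz (\sum_(x <- L' ++ O) charge D' x * linking x y)) ->
  index_extension D = index_extension D'.
Proof.
move=> HL HL' HO cntL sumO sumL.
have n' : num_singular D' = num_singular D.
  rewrite (singular_listing HL) (singular_listing HL') !count_cat cntL.
  by congr addn; apply: eq_in_count => x /HO[-> _].
rewrite (index_extension_listing HL) (index_extension_listing HL') n'.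
rewrite big_cat [RHS]big_cat sumL; congr (_ + _); apply: eq_big_seq => y yO.
have [mE fE] := HO _ yO.
have wE : weight (num_singular D) D' y = weight (num_singular D) D y.
  rewrite /weight -mE; case: (num_singular D) => [|[|n]] //.
  by rewrite /sgn -mE !(flat_signC _ y.1 y.2) fE.
rewrite wE; have [->|w0] := eqVneq (weight (num_singular D) D y) 0.
  by rewrite !scale0r.
rewrite !big_cat /= sumO //; congr (_ *: index_term (absz (_ + _))).
by apply: eq_big_seq => z zO; rewrite /charge; have [-> ->] := HO _ zO.
Qed.

End Extension.

(** * Plane curves and straight chords *)

Section Zeros.
Variable R : realType.
Implicit Types (f g : R -> R) (a b s t z d : R).

Lemma sgz_no_zero f a b : a <= b -> {within `[a, b], continuous f} ->
  (forall t, a <= t <= b -> f t != 0) -> sgz (f a) = sgz (f b).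
Proof.
move=> ab fc f0.
have fa0 : f a != 0 by apply: f0; rewrite lexx.
have fb0 : f b != 0 by apply: f0; rewrite lexx ab.
apply/eqP; apply: contraT => sfab.
have : exists2 c, c \in `[a, b] & f c = 0.
  apply: IVT => //.
  case: (ltrgtP (f a) 0) fa0 sfab => // fa _; case: (ltrgtP (f b) 0) fb0 => // fb _.
  - by rewrite !ltr0_sgz // eqxx.
  - by move=> _; rewrite minEle maxEle (ltW (lt_trans fa fb)) !ltW.
  - by move=> _; rewrite minElt maxElt ltNge (ltW (lt_trans fb fa)) /= !ltW.
  - by rewrite !gtr0_sgz // eqxx.
by case=> c; rewrite in_itv /= => /f0/eqP.
Qed.

(* Divide out the zero: the quotient f t / (t - z), extended by d at z, is
   continuous and vanishes nowhere. *)
Lemma sgz_simple_zero f z d a b : continuous f -> is_derive z 1 f d ->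
  d != 0 -> f z = 0 -> a <= z <= b ->
  (forall t, a <= t <= b -> f t = 0 -> t = z) ->
  forall t, a <= t <= b -> sgz (f t) = sgz (t - z) * sgz d.
Proof.
move=> fc /is_derive1_caratheodory[g [gE gz gd]] d0 fz azb zeros t atb.
rewrite fz in gE; have {}gE u : f u = g u * (u - z) by rewrite -gE subr0.
have gc : continuous g.
  (* At [z] continuity is part of the Caratheodory criterion; elsewhere [g] agrees with the quotient
     on a neighbourhood of [u]. *)
  move=> u; have [->|uz] := eqVneq u z; first exact: gz.
  have gu : \forall w \near u, f w / (w - z) = g w.
    near=> w; rewrite gE mulfK // subr_eq0.
    by near: w; apply: open_nbhs_nbhs; split; [exact: open_neq|exact: uz].
  rewrite /continuous_at -(nbhs_singleton gu).
  apply: cvg_trans; first exact: (near_eq_cvg gu).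
  apply: cvgM; first exact: fc.
  apply: cvgV; first by rewrite subr_eq0.
  by apply: cvgB; [exact: cvg_id|exact: cvg_cst].
have g0 u : a <= u <= b -> g u != 0.
  move=> uab; apply/eqP => gu0; have uz := zeros u uab.
  by move: d0; rewrite -gd -uz ?gu0 ?eqxx // gE gu0 mul0r.
rewrite gE sgzM mulrC -gd; congr (_ * _).
case/andP: azb => az zb; case/andP: atb => at' tb.
have [tz|zt] := leP t z.
  apply: sgz_no_zero => //; first exact: continuous_subspaceT.
  by move=> u /andP[tu uz]; apply: g0; rewrite (le_trans at') //= (le_trans uz).
apply/esym; apply: sgz_no_zero; rewrite ?ltW //; first exact: continuous_subspaceT.
by move=> u /andP[tu uz]; apply: g0; rewrite (le_trans az) //= (le_trans uz).
Unshelve. all: by end_near. Qed.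

(** At the midpoint of the two zeros, the sign of [f] is that of [d1] when read from [s1] and the
    opposite of that of [d2] when read from [s2]. *)
Lemma sgz_two_zeros f a b s1 s2 d1 d2 : continuous f ->
  is_derive s1 1 f d1 -> is_derive s2 1 f d2 -> d1 != 0 -> d2 != 0 ->
  f s1 = 0 -> f s2 = 0 -> s1 < s2 -> a <= s1 -> s2 <= b ->
  (forall t, a <= t <= b -> f t = 0 -> t = s1 \/ t = s2) ->
  sgz d2 = - sgz d1.
Proof.
move=> fc D1 D2 d10 d20 f1 f2 lt12 as1 s2b zeros.
pose w := (s1 + s2) / 2; have [sw ws] : s1 < w /\ w < s2 by rewrite /w; split; lra.
have E1 : sgz (f w) = sgz (w - s1) * sgz d1.
  apply: (@sgz_simple_zero f s1 d1 s1 w) => //; rewrite ?lexx ?ltW //.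
  by move=> t /andP[? ?] ft; case: (zeros t _ ft); lra.
have E2 : sgz (f w) = sgz (w - s2) * sgz d2.
  apply: (@sgz_simple_zero f s2 d2 w s2) => //; rewrite ?lexx ?ltW //.
  by move=> t /andP[? ?] ft; case: (zeros t _ ft); lra.
have w1 : sgz (w - s1) = 1 by rewrite gtr0_sgz // subr_gt0.
have w2 : sgz (w - s2) = -1 by rewrite ltr0_sgz // subr_lt0.
by move: E2; rewrite E1 w1 w2 mul1r mulN1r => ->; rewrite opprK.
Qed.
End Zeros.

Section Curves.
Variable R : realType.
Implicit Types (D : diagram R) (I J m c p q v : R * R) (r s t : R).

Lemma is_derive_curve1 D t :
  is_derive t 1 (fun s => (D s).1) (tangent D t).1.
Proof.
have [dD _ _ _] := curve_immersion D; have [d1 _] := dD t.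
by rewrite /= derive1E; apply: DeriveDef.
Qed.

Lemma is_derive_curve2 D t :
  is_derive t 1 (fun s => (D s).2) (tangent D t).2.
Proof.
have [dD _ _ _] := curve_immersion D; have [_ d2] := dD t.
by rewrite /= derive1E; apply: DeriveDef.
Qed.

(** Positive to the left of the line through [p] directed by [v]. The derivative along a curve is
    the determinant whose sign is the flat sign of a crossing with this line. *)
Definition line_side p v (q : R * R) : R := det2 v (q - p).

Lemma is_derive_line_side D p v t :
  is_derive t 1 (fun s => line_side p v (D s)) (det2 v (tangent D t)).
Proof.
have d1 := is_derive_curve1 D t; have d2 := is_derive_curve2 D t.
rewrite /line_side /det2 /=; apply: is_derive_eq.
by rewrite /GRing.scale /= !subr0.
Qed.

Lemma continuous_line_side D p v : continuous (fun s => line_side p v (D s)).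
Proof.
move=> t; apply: differentiable_continuous; apply/derivable1_diffP.
by case: (is_derive_line_side D p v t).
Qed.

Lemma eq_tangent (g h : R -> R * R) t :
  (\near t, g t = h t) -> tangent g t = tangent h t.
Proof.
move=> gh; rewrite /tangent !derive1E; congr (_, _); apply: near_eq_derive.
  by apply: filterS gh => s ->.
by apply: filterS gh => s ->.
Qed.

Definition straight_along D p v I :=
  forall t, I.1 <= t <= I.2 -> D t = p + t *: v.

Lemma straight_tangent D p v I t :
  straight_along D p v I -> on_arc I t -> tangent D t = v.
Proof.
move=> DI It; have near_line : \near t, D t = p + t *: v.
  have : \near t, t \in `]I.1, I.2[.
    by apply: near_in_itvoo; rewrite in_itv.
  by apply: filterS => s; rewrite in_itv /= => /andP[/ltW a /ltW b]; apply: DI; rewrite a b.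
have D1 (a b : R) : 'D_1 (fun s => a + s * b) t = b.
  by rewrite derive_val add0r mul1r scaler0 add0r /GRing.scale /= mulr1.
have -> : tangent D t = tangent (fun s => p + s *: v) t by exact: eq_tangent.
by rewrite /tangent !derive1E !D1 -surjective_pairing.
Qed.

Lemma straight_neq0 D p v I : I.1 < I.2 -> straight_along D p v I -> v != (0, 0).
Proof.
move=> ltI DI; have [_ _ _ nz] := curve_immersion D.
have mid : on_arc I ((I.1 + I.2) / 2) by rewrite /on_arc; apply/andP; split; lra.
by rewrite -(straight_tangent DI mid).
Qed.

Lemma straight_inj D p v I s t : straight_along D p v I ->
  I.1 <= s <= I.2 -> I.1 <= t <= I.2 -> D s = D t -> s = t.
Proof.
move=> DI sI tI; have [|] := boolP (I.1 < I.2); last by move: sI tI; lra.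
move=> ltI; have := straight_neq0 ltI DI; rewrite (DI _ sI) (DI _ tI).
case: v {DI} => a b; rewrite xpair_eqE negb_and /= => ab [].
move=> /addrI E1 /addrI E2; case/orP: ab => n0.
  by apply: (mulIf n0).
by apply: (mulIf n0).
Qed.

Lemma sqdistE p v c t : sqdist (p + t *: v) c =
  (v.1 ^+ 2 + v.2 ^+ 2) * t ^+ 2
  + 2 * ((p.1 - c.1) * v.1 + (p.2 - c.2) * v.2) * t + sqdist p c.
Proof. by rewrite /sqdist /= /GRing.scale /=; ring. Qed.

(* A line meets a disc in a segment, so a chord is the whole of this segment. *)
Lemma chord_full D p v I c r q : I.1 < I.2 -> straight_along D p v I ->
  circle c r (D I.1) -> circle c r (D I.2) -> closed_disc c r q ->
  line_side p v q = 0 -> exists2 w, I.1 <= w <= I.2 & D w = q.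
Proof.
move=> ltI DI; rewrite (DI I.1) ?lexx ?ltW // (DI I.2) ?lexx ?ltW //.
rewrite /circle /closed_disc /line_side /det2 /= !sqdistE => E1 E2 Hq side0.
have := straight_neq0 ltI DI; rewrite (surjective_pairing v) xpair_eqE negb_and => v0.
have N0 : 0 < v.1 ^+ 2 + v.2 ^+ 2.
  rewrite lt_neqAle addr_ge0 ?sqr_ge0 // andbT eq_sym paddr_eq0 ?sqr_ge0 //.
  by rewrite !sqrf_eq0 negb_and.
(* The parameter of the orthogonal projection of [q] to the line, hence of [q] itself because [q]
   lies on the line. *)
pose w := ((q.1 - p.1) * v.1 + (q.2 - p.2) * v.2) / (v.1 ^+ 2 + v.2 ^+ 2).
have qE : q = p + w *: v.
  have wN : w * (v.1 ^+ 2 + v.2 ^+ 2) = (q.1 - p.1) * v.1 + (q.2 - p.2) * v.2.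
    by rewrite /w divfK // gt_eqF.
  rewrite (surjective_pairing q) (surjective_pairing p); congr (_, _) => /=;
    apply: (mulIf (lt0r_neq0 N0)); rewrite /GRing.scale /= mulrDl mulrAC wN.
    by move/(congr1 ( *%R v.2)): side0; rewrite /=; lra.
  by move/(congr1 ( *%R v.1)): side0; rewrite /=; lra.
suff wI : I.1 <= w <= I.2 by exists w; rewrite ?DI.
move: Hq; rewrite qE sqdistE.
move: E1 E2 N0; set N := (v.1 ^+ 2 + _); set B := 2 * _; set C := sqdist p c.
move: (I.1) (I.2) ltI (r ^+ 2) => a b ab S E1 E2 N0 Hw.
(* Along the line, the squared distance to the centre minus the squared radius is a quadratic with
   roots [a] and [b], hence equal to N (t - a) (t - b). It is nonpositive at [w], which puts [w]
   between the roots. *)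
have BE : B = - N * (a + b).
  apply/eqP; rewrite -subr_eq0; apply/eqP; apply: (@mulfI _ (a - b)).
    by rewrite subr_eq0 lt_eqF.
  by rewrite mulr0; nra.
have : N * ((w - a) * (w - b)) <= 0 by move: Hw E1; rewrite BE; nra.
by rewrite pmulr_rle0 // => H; apply/andP; split; nra.
Qed.

End Curves.

(** * Local changes of a diagram *)

Section Arcs.
Variable R : realType.
Implicit Types (I J m x y : R * R) (r s t w : R) (arcs : seq (R * R)).

Definition disjoint_arcs I J := (I.2 < J.1) || (J.2 < I.1).

Definition off_arcs arcs t := all (fun I => ~~ on_arc I t) arcs.

Lemma off_arcsP arcs t : ~~ off_arcs arcs t -> exists2 I, I \in arcs & on_arc I t.
Proof. by move/allPn => [I Iarcs]; rewrite negbK; exists I. Qed.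

Lemma on_off_arcs arcs I t : I \in arcs -> on_arc I t -> ~~ off_arcs arcs t.
Proof. by move=> Iarcs It; apply/allPn; exists I; rewrite ?negbK. Qed.

Lemma disjoint_off I J t : disjoint_arcs I J -> I.1 <= t <= I.2 -> ~~ on_arc J t.
Proof. by rewrite /disjoint_arcs /on_arc => /orP[] ? /andP[? ?]; apply/negP; lra. Qed.

Lemma disjoint_arcsC I J : disjoint_arcs I J = disjoint_arcs J I.
Proof. by rewrite /disjoint_arcs orbC. Qed.

Lemma on_arcW I t : on_arc I t -> I.1 <= t <= I.2.
Proof. by case/andP=> ? ?; rewrite !ltW. Qed.

(** Since [linking] sees only the order of parameters, moving a parameter inside an arc that avoids
    the others leaves it unchanged. The lemmas below on [linking] rest on this. *)
Lemma sgz_off_arc I s t w :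
  on_arc I s -> on_arc I t -> ~~ on_arc I w -> sgz (w - s) = sgz (w - t).
Proof.
rewrite /on_arc => /andP[? ?] /andP[? ?] ofw; have [wI|Iw] := leP w I.1.
  by rewrite !ltr0_sgz //; lra.
have {}ofw : I.2 <= w by rewrite leNgt; apply: contra ofw => ->; rewrite Iw.
by rewrite !gtr0_sgz //; lra.
Qed.

Lemma sgz_off_arcr I s t w :
  on_arc I s -> on_arc I t -> ~~ on_arc I w -> sgz (s - w) = sgz (t - w).
Proof.
move=> Is It Iw; rewrite -opprB -[t - w]opprB !sgzN.
by rewrite (sgz_off_arc Is It Iw).
Qed.

Lemma linking_same_arc I s t y : on_arc I s -> on_arc I t ->
  ~~ on_arc I y.1 -> ~~ on_arc I y.2 -> linking (s, t) y = 0.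
Proof.
move=> Is It Iy1 Iy2; rewrite /linking /=.
by rewrite (sgz_off_arc Is It Iy1) (sgz_off_arc Is It Iy2); ring.
Qed.

Lemma linkingC x y : linking x y = - linking y x.
Proof.
have E s t : sgz (s - t) = - sgz (t - s) by rewrite -opprB sgzN.
by rewrite /linking (E y.1 x.1) (E y.1 x.2) (E y.2 x.1) (E y.2 x.2); ring.
Qed.

Lemma linking_arcs I J s t s' t' y : on_arc I s -> on_arc I s' ->
  on_arc J t -> on_arc J t' -> ~~ on_arc I y.1 -> ~~ on_arc I y.2 ->
  ~~ on_arc J y.1 -> ~~ on_arc J y.2 -> linking (s, t) y = linking (s', t') y.
Proof.
move=> Is Is' Jt Jt' Iy1 Iy2 Jy1 Jy2; rewrite /linking /=.
rewrite (sgz_off_arc Is Is' Iy1) (sgz_off_arc Is Is' Iy2).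
by rewrite (sgz_off_arc Jt Jt' Jy1) (sgz_off_arc Jt Jt' Jy2).
Qed.

End Arcs.

Section Tangles.
Variable R : realType.
Implicit Types (D : diagram R) (c I J m x y : R * R) (r s t w : R).
Implicit Types (arcs chords L O : seq (R * R)).

Section Tangle.
Variables (D : diagram R) (c : R * R) (r : R) (arcs : seq (R * R)).
Hypothesis T : tangle_in D c r arcs.

Lemma tangle_lt I : I \in arcs -> I.1 < I.2.
Proof. by case: T => [[_ /allP lt _] _]; apply: lt. Qed.

Lemma tangle_disjoint I J :
  I \in arcs -> J \in arcs -> I = J \/ disjoint_arcs I J.
Proof.
have [[_ _ P] _] := T; move: arcs P => s; elim: s => //= K s IH /andP[/allP Ks /IH{}IH].
rewrite !inE => /orP[/eqP->|Is] /orP[/eqP->|Js].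
- by left.
- by right; apply: Ks.
- by right; rewrite disjoint_arcsC; apply: Ks.
- exact: IH.
Qed.

Lemma tangle_open I t : I \in arcs -> I.1 <= t <= I.2 ->
  open_disc c r (D t) -> on_arc I t.
Proof.
move=> Is It; case: T => _ [_ op _] /op[J Js Jt].
have [->//|dIJ] := tangle_disjoint Is Js.
by have := disjoint_off dIJ It; rewrite Jt.
Qed.

(** No double point lies on the circle, so a double point in the closed disc is in the open disc and
    its parameter is not an end of the arc. *)
Lemma tangle_meet_on I s t : I \in arcs -> I.1 <= s <= I.2 ->
  self_meets D s t -> on_arc I s.
Proof.
move=> Is Iss st; apply: tangle_open => //.
have [_ [cl _ circ]] := T; have : closed_disc c r (D s) by apply/cl; exists I.
have := circ _ _ st; rewrite /circle /closed_disc /open_disc /=.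
by rewrite le_eqVlt => nE /orP[/eqP|].
Qed.

Lemma tangle_meet I s t : I \in arcs -> on_arc I s ->
  self_meets D s t -> exists2 J, J \in arcs & on_arc J t.
Proof.
move=> Is Iss st; have [_ [_ op _]] := T.
have : open_disc c r (D s) by apply/op; exists I.
by have [_ ->] := st; move/op.
Qed.

(** An end of an arc lies in the closed disc. In the open disc it would be interior to some arc,
    which is impossible as the arcs are disjoint. *)
Lemma tangle_circle I : I \in arcs -> circle c r (D I.1) /\ circle c r (D I.2).
Proof.
move=> Is; have ltI := tangle_lt Is; have [_ [cl _ _]] := T.
have end_circle t : I.1 <= t <= I.2 -> ~~ on_arc I t -> circle c r (D t).
  move=> It nIt; have : closed_disc c r (D t) by apply/cl; exists I.
  rewrite /closed_disc /circle /= le_eqVlt => /orP[/eqP//|lt].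
  by rewrite (tangle_open Is It) in nIt.
by split; apply: end_circle; rewrite /on_arc ?lexx ?ltxx ?ltW ?andbF.
Qed.

Definition outside := [seq x <- dps D | off_arcs arcs x.1 && off_arcs arcs x.2].

(** The two parameters of a double point are both on the arcs or both off them, since membership in
    the open disc depends only on the image point. Hence [L] need only account for the double points
    inside the disc. *)
Lemma listing_local L : uniq L ->
  (forall x, x \in L -> self_meets D x.1 x.2 /\ ~~ off_arcs arcs x.1) ->
  (forall x, x \in L -> (x.2, x.1) \notin L) ->
  (forall s t, self_meets D s t -> ~~ off_arcs arcs s -> ~~ off_arcs arcs t ->
     ((s, t) \in L) || ((t, s) \in L)) ->
  listing D (L ++ outside).
Proof.
move=> uL L_meet L_anti L_cover; have [uD D_meet D_anti D_cover] := listing_dps D.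
have meet_off s t : self_meets D s t -> off_arcs arcs s = off_arcs arcs t.
  move=> st; have ts := self_meets_sym st.
  have [|/off_arcsP[I Is Iss]] := boolP (off_arcs arcs s).
    move=> ofs; apply/esym; apply: contraLR ofs => /off_arcsP[I Is It].
    by have [J Js Jt] := tangle_meet Is It ts; apply: on_off_arcs Js Jt.
  by have [J Js Jt] := tangle_meet Is Iss st; rewrite (negbTE (on_off_arcs Js Jt)).
split.
- rewrite cat_uniq uL filter_uniq // andbT /=; apply/hasPn => x.
  rewrite mem_filter => /andP[/andP[of1 _] _]; apply/negP => /L_meet[_].
  by rewrite of1.
- by move=> x; rewrite mem_cat mem_filter => /orP[/L_meet[]|/andP[_ /D_meet]].
- move=> x; rewrite !mem_cat !mem_filter /= => xin; apply/norP; split.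
    case/orP: xin => [/L_anti//|/andP[/andP[_ of2] _]].
    by apply/negP => /L_meet[_]; rewrite of2.
  rewrite negb_and; case/orP: xin => [/L_meet[_ /negbTE->]|/andP[_ /D_anti ->]].
    by rewrite andbF.
  by rewrite orbT.
move=> s t st; rewrite !mem_cat !mem_filter /=.
have := D_cover _ _ st; have := L_cover _ _ st; rewrite -(meet_off _ _ st).
case: off_arcs => /= [_ /orP[]->|/(_ isT isT) /orP[]->]; rewrite ?orbT //.
Qed.

End Tangle.

Lemma eq_listing D xs ys : perm_eq xs ys -> listing D xs -> listing D ys.
Proof.
move=> E [u a b cv]; split; first by rewrite -(perm_uniq E).
- by move=> x; rewrite -(perm_mem E); apply: a.
- by move=> x; rewrite -!(perm_mem E); apply: b.
- by move=> s t; rewrite -!(perm_mem E); apply: cv.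
Qed.

Section LocalChange.
Variables (D D' : diagram R) (c : R * R) (r : R) (m : R * R) (chords : seq (R * R)).
Hypothesis LC : local_change D D' c r m chords.

Lemma local_tangle : tangle_in D c r (m :: chords).
Proof. by case: LC. Qed.

Lemma local_tangle' : tangle_in D' c r (m :: chords).
Proof. by case: LC. Qed.

Lemma local_eq t : ~~ on_arc m t -> D t = D' t.
Proof. by case: LC => _ _ _ H _; apply: H. Qed.

(** A double point is not on the circle, so a parameter of it off the open arc [m] is not an end of
    [m] either, and the two curves agree on a neighbourhood of it. *)
Lemma local_tangent s t : self_meets D s t -> ~~ on_arc m s ->
  tangent D s = tangent D' s.
Proof.
move=> st ms; apply: eq_tangent.
have : (s < m.1) || (m.2 < s).
  apply: contraR ms; rewrite negb_or -!leNgt => sm.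
  by apply: (tangle_meet_on local_tangle _ _ st); rewrite ?mem_head.
case/orP => H.
  have : \near s, s \in `]-oo, m.1[ by apply: near_in_itvNyo; rewrite in_itv.
  by apply: filterS => w; rewrite in_itv /= => wm; apply: local_eq; rewrite /on_arc; lra.
have : \near s, s \in `]m.2, +oo[ by apply: near_in_itvoy; rewrite in_itv /= H.
by apply: filterS => w; rewrite in_itv /= andbT => wm; apply: local_eq; rewrite /on_arc; lra.
Qed.

Lemma local_flat_sign s t : self_meets D s t -> ~~ on_arc m s -> ~~ on_arc m t ->
  flat_sign D s t = flat_sign D' s t.
Proof.
move=> st ms mt; rewrite /flat_sign (local_tangent st ms).
by rewrite (local_tangent (self_meets_sym st) mt).
Qed.

Lemma local_mark s t : self_meets D s t -> ~~ on_arc m s -> ~~ on_arc m t ->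
  mark D s t = mark D' s t.
Proof. by case: LC => _ _ _ _ H; apply: H. Qed.

Lemma outside_local x : x \in outside D (m :: chords) ->
  [/\ self_meets D x.1 x.2, ~~ on_arc m x.1 & ~~ on_arc m x.2] /\
  {in chords, forall I, ~~ on_arc I x.1 /\ ~~ on_arc I x.2}.
Proof.
rewrite mem_filter /= => /andP[/andP[/andP[-> /allP o1] /andP[-> /allP o2]]].
have [_ H _ _] := listing_dps D; move/H => xx; split=> // I Ic.
by rewrite o1 ?o2.
Qed.

Lemma outside_eq x : x \in outside D (m :: chords) ->
  mark D x.1 x.2 = mark D' x.1 x.2 /\ flat_sign D x.1 x.2 = flat_sign D' x.1 x.2.
Proof.
by case/outside_local => -[xx m1 m2] _; rewrite local_mark ?local_flat_sign.
Qed.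

Lemma perm_outside : perm_eq (outside D' (m :: chords)) (outside D (m :: chords)).
Proof.
apply: uniq_perm; try by rewrite filter_uniq // fset_uniq.
move=> x; rewrite !mem_filter !mem_dps; case: (boolP (off_arcs _ _ && _)) => //=.
by case/andP => /andP[m1 _] /andP[m2 _]; rewrite (local_eq m1) (local_eq m2).
Qed.

(** Invariance is reduced to the disc: the inner crossings must act equally on the outer indices,
    and their own terms must have equal sums. *)
Lemma local_change_invariance f L L' :
  listing D (L ++ outside D (m :: chords)) ->
  listing D' (L' ++ outside D' (m :: chords)) ->
  count (fun x => singular (mark D x.1 x.2)) L =
    count (fun x => singular (mark D' x.1 x.2)) L' ->
  (forall y, y \in outside D (m :: chords) ->
     \sum_(x <- L) charge D x * linking x y =
     \sum_(x <- L') charge D' x * linking x y) ->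
  \sum_(y <- L) weight (num_singular D) D y *: index_term f
    (absz (\sum_(x <- L ++ outside D (m :: chords)) charge D x * linking x y)) =
  \sum_(y <- L') weight (num_singular D) D' y *: index_term f
    (absz (\sum_(x <- L' ++ outside D (m :: chords)) charge D' x * linking x y)) ->
  index_extension f D = index_extension f D'.
Proof.
move=> HL HL' cnt sO sL; apply: (@local_invariance _ f D D' L L' (outside D (m :: chords))) => //.
- by apply: eq_listing HL'; rewrite perm_cat2l perm_outside.
- exact: outside_eq.
- by move=> y yO _; apply: sO.
Qed.

End LocalChange.
End Tangles.

(** * Kinks and crossings with a chord *)

Section KinkMoves.
Variable R : realType.
Implicit Types (D : diagram R) (c I J m x y : R * R) (r s t w : R).

Lemma self_crossings_meet D m xs s t : self_crossings D m xs ->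
  (s, t) \in xs -> [/\ on_arc m s, on_arc m t, s < t & self_meets D s t].
Proof. by move=> X /X[ms mt st eq]; split=> //; split; rewrite // lt_eqF. Qed.

Lemma self_crossings_cover D m xs s t : self_crossings D m xs ->
  self_meets D s t -> on_arc m s -> on_arc m t -> ((s, t) \in xs) || ((t, s) \in xs).
Proof.
move=> X [neq eq] ms mt; case: (ltrgtP s t) neq => // st _; apply/orP.
  by left; apply/X.
by right; apply/X; split.
Qed.

Lemma listing_kinks D c r m xs : tangle_in D c r [:: m] -> uniq xs ->
  self_crossings D m xs -> listing D (xs ++ outside D [:: m]).
Proof.
move=> T uxs X; apply: (listing_local T) => // [[s t]|[s t]|s t st].
- case/(self_crossings_meet X) => ms _ _ st; split=> //.
  by apply: on_off_arcs ms; rewrite mem_head.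
- case/(self_crossings_meet X) => _ _ lt _; apply/negP.
  by case/(self_crossings_meet X) => _ _; rewrite ltNge ltW.
rewrite /off_arcs /= !andbT !negbK; exact: self_crossings_cover.
Qed.

(** No outer crossing has a parameter between the two parameters of a kink, so only crossings on the
    same arc could contribute to its index. *)
Lemma kink_index D m (L : seq (R * R)) s t : on_arc m s -> on_arc m t ->
  \sum_(x <- L) charge D x * linking x (s, t) = 0 ->
  \sum_(x <- L ++ outside D [:: m]) charge D x * linking x (s, t) = 0.
Proof.
move=> ms mt; rewrite big_cat /= => ->; rewrite add0r big_seq big1 // => x.
case/outside_local => -[_ m1 m2] _.
by rewrite linkingC (linking_same_arc ms mt m1 m2) oppr0 mulr0.
Qed.

Lemma weight_virtual n D x : virtual (mark D x.1 x.2) -> weight n D x = 0.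
Proof. by rewrite /weight /sgn; case: n => [|[|n]]; case: mark. Qed.

(** A virtual kink has no weight. A classical kink has index 0, and in the unframed case its term
    t^0 - 1 vanishes. *)
Lemma kink_invariance f (ok : pred kind) D D' : kink_move ok D D' ->
  (forall k, ok k -> virtual k || classical k && (if f is Unframed then true else false)) ->
  index_extension f D = index_extension f D'.
Proof.
case=> [c [r [m [s [t [LC X X' okm]]]]]] okE; have {okE okm} := okE _ okm => okm.
have [ms mt lt st] := self_crossings_meet X (mem_head _ _).
have HL := listing_kinks (local_tangle LC) (isT : uniq [:: (s, t)]) X.
have HL' := listing_kinks (local_tangle' LC) (isT : uniq ([::] : seq (R * R))) X'.
apply: (local_change_invariance LC HL HL').
- by rewrite /= addn0; case: mark okm.
- move=> y /outside_local[[_ m1 m2] _]; rewrite big_seq1 big_nil.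
  by rewrite (linking_same_arc ms mt m1 m2) mulr0.
rewrite big_seq1 big_nil (kink_index ms mt) ?big_seq1 ?linkingxx ?mulr0 //.
case/orP: okm => [V|]; first by rewrite (@weight_virtual _ D (s, t) V) scale0r.
by case: (f); rewrite ?andbF //= expr0 subrr scaler0.
Qed.

(** Both kinks have index 0, so their terms differ only by the opposite signs and cancel. *)
Lemma double_kink_invariance f D D' : double_kink_move D D' ->
  index_extension f D = index_extension f D'.
Proof.
case=> [c [r [m [s1 [t1 [s2 [t2 [[LC X X' lt12] [c1 c2 sg]]]]]]]]].
have [ms1 mt1 lt1 st1] := self_crossings_meet X (mem_head _ _).
have [ms2 mt2 lt2 st2] : [/\ on_arc m s2, on_arc m t2, s2 < t2 & self_meets D s2 t2].
  by apply: (self_crossings_meet X); rewrite !inE eqxx orbT.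
have uL : uniq [:: (s1, t1); (s2, t2)].
  by rewrite /= inE xpair_eqE andbT negb_and (lt_eqF (lt_trans lt1 lt12)).
have HL := listing_kinks (local_tangle LC) uL X.
have HL' := listing_kinks (local_tangle' LC) (isT : uniq ([::] : seq (R * R))) X'.
(* The kinks are consecutive: s1 < t1 < s2 < t2. *)
have link12 : linking (s1, t1) (s2, t2) = 0.
  by rewrite /linking /= !gtr0_sgz ?subr_gt0; first ring; lra.
apply: (local_change_invariance LC HL HL').
- by rewrite /=; case: mark c1; case: mark c2.
- move=> y /outside_local[[_ m1 m2] _]; rewrite !big_cons !big_nil.
  by rewrite (linking_same_arc ms1 mt1 m1 m2) (linking_same_arc ms2 mt2 m1 m2) !mulr0 !addr0.
have i1 := kink_index ms1 mt1 (L := [:: (s1, t1); (s2, t2)]).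
have i2 := kink_index ms2 mt2 (L := [:: (s1, t1); (s2, t2)]).
rewrite [RHS]big_nil [LHS]big_cons {}i1; last first.
  by rewrite !big_cons big_nil linkingxx linkingC link12 oppr0 !mulr0 !addr0.
rewrite big_seq1 {}i2; last first.
  by rewrite !big_cons big_nil linkingxx link12 !mulr0 !addr0.
rewrite -scalerDl (_ : _ + _ = 0) ?scale0r //.
case: (num_singular D) => [|[|n]] //=; first by rewrite sg addNr.
by case: mark c1; case: mark c2.
Qed.
End KinkMoves.

(** * Signs of crossings with a straight chord *)

Section Chords.
Variable R : realType.
Implicit Types (D : diagram R) (c I J m x y p q v : R * R) (r s t w : R).
Implicit Types (arcs : seq (R * R)).

(** By [chord_full] the chord is all that the line has in common with the disc, so every zero of
    [line_side] along [m] is a genuine crossing with [I]. *)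
Lemma line_zeros D c r arcs m I p v t : tangle_in D c r arcs ->
  m \in arcs -> I \in arcs -> disjoint_arcs m I -> straight_along D p v I ->
  m.1 <= t <= m.2 -> line_side p v (D t) = 0 ->
  exists w, [/\ on_arc m t, on_arc I w & D t = D w].
Proof.
move=> T mA IA mI DI tm side0; have [C1 C2] := tangle_circle T IA.
have clt : closed_disc c r (D t) by case: (T) => _ [cl _ _]; apply/cl; exists m.
have [w wI wt] := chord_full (tangle_lt T IA) DI C1 C2 clt side0.
have tw : self_meets D t w.
  split=> //; apply: contraTneq mI => tw; rewrite -tw in wI.
  by case/andP: tm wI => ? ? /andP[? ?]; apply/negP => /orP[] ?; lra.
exists w; split; last by [].
  exact: tangle_meet_on T _ _ _ mA tm tw.
exact: tangle_meet_on T _ _ _ IA wI (self_meets_sym tw).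
Qed.

Lemma line_side_straight D p v I t : straight_along D p v I ->
  I.1 <= t <= I.2 -> line_side p v (D t) = 0.
Proof.
by move=> DI tI; rewrite DI // /line_side /det2 /= /GRing.scale /=; ring.
Qed.

Lemma transverse D s t : self_meets D s t -> det2 (tangent D s) (tangent D t) != 0.
Proof. by case: (curve_generic D) => H _ _; apply: H. Qed.

Lemma crossings_meet D I J xs s t : disjoint_arcs I J ->
  crossings_between D I J xs -> (s, t) \in xs ->
  [/\ on_arc I s, on_arc J t & self_meets D s t].
Proof.
move=> IJ X /X[Is Jt eq]; split=> //; split=> //.
by apply: contraTneq Jt => <-; apply: disjoint_off IJ (on_arcW Is).
Qed.

(* The sign of the crossing at x is read off the side of the chord on which the
   other arc leaves the disc. *)
Lemma flat_sign_crossing D c r arcs m I p v x t : tangle_in D c r arcs ->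
  m \in arcs -> I \in arcs -> disjoint_arcs m I -> straight_along D p v I ->
  crossings_between D m I [:: x] -> m.1 <= t <= m.2 ->
  sgz (line_side p v (D t)) = sgz (t - x.1) * flat_sign D x.2 x.1.
Proof.
move=> T mA IA mI DI; case: x => a b X tm.
have [ma Ib ab] := crossings_meet mI X (mem_head _ _).
rewrite /flat_sign (straight_tangent DI Ib) /=.
apply: (@sgz_simple_zero _ (fun s => line_side p v (D s)) a _ m.1 m.2) (tm) => //.
- exact: continuous_line_side.
- exact: is_derive_line_side.
- by rewrite -(straight_tangent DI Ib); apply: transverse (self_meets_sym ab).
- by rewrite (proj2 ab); apply: line_side_straight DI (on_arcW Ib).
- exact: on_arcW.
move=> w wm w0; have [z [mw Iz wz]] := line_zeros T mA IA mI DI wm w0.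
by have /X : [/\ on_arc m w, on_arc I z & D w = D z] by []; rewrite inE => /eqP[].
Qed.

(** Along [m], [line_side] has exactly two zeros, both simple by transversality, so it crosses 0 in
    opposite directions. *)
Lemma bigon_flat_sign_lt D c r arcs m I s1 t1 s2 t2 : tangle_in D c r arcs ->
  m \in arcs -> I \in arcs -> disjoint_arcs m I -> straight D I ->
  crossings_between D m I [:: (s1, t1); (s2, t2)] -> s1 < s2 ->
  flat_sign D s2 t2 = - flat_sign D s1 t1.
Proof.
move=> T mA IA mI [p [v DI]] X lt12.
have [ms1 It1 st1] := crossings_meet mI X (mem_head _ _).
have [ms2 It2 st2] : [/\ on_arc m s2, on_arc I t2 & self_meets D s2 t2].
  by apply: (crossings_meet mI X); rewrite !inE eqxx orbT.
rewrite -(flat_signC D s1) (flat_signC D t2) /flat_sign.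
rewrite (straight_tangent DI It1) (straight_tangent DI It2).
suff -> : sgz (det2 v (tangent D s2)) = - sgz (det2 v (tangent D s1)) by rewrite opprK.
apply: (@sgz_two_zeros _ (fun s => line_side p v (D s)) m.1 m.2 s1 s2) (lt12) _ _ _ => //.
- exact: continuous_line_side.
- exact: is_derive_line_side.
- exact: is_derive_line_side.
- by rewrite -(straight_tangent DI It1); apply: transverse (self_meets_sym st1).
- by rewrite -(straight_tangent DI It2); apply: transverse (self_meets_sym st2).
- by rewrite (proj2 st1); apply: line_side_straight DI (on_arcW It1).
- by rewrite (proj2 st2); apply: line_side_straight DI (on_arcW It2).
- by case/andP: ms1 => /ltW.
- by case/andP: ms2 => _ /ltW.
move=> w wm w0; have [z [mw Iz wz]] := line_zeros T mA IA mI DI wm w0.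
have /X : [/\ on_arc m w, on_arc I z & D w = D z] by [].
by rewrite !inE => /orP[] /eqP[]; [left|right].
Qed.

(** The version for crossings in either order along [m], as they occur in a vertex twist. *)
Lemma bigon_flat_sign D c r arcs m I s1 t1 s2 t2 : tangle_in D c r arcs ->
  m \in arcs -> I \in arcs -> disjoint_arcs m I -> straight D I ->
  crossings_between D m I [:: (s1, t1); (s2, t2)] -> s1 != s2 ->
  flat_sign D s2 t2 = - flat_sign D s1 t1.
Proof.
move=> T mA IA mI SI X; case: (ltrgtP s1 s2) => // lt12 _.
  exact: (bigon_flat_sign_lt T mA IA mI SI X lt12).
have X' : crossings_between D m I [:: (s2, t2); (s1, t1)].
  by move=> s t; rewrite !inE orbC; have := X s t; rewrite !inE.
by rewrite (bigon_flat_sign_lt T mA IA mI SI X' lt12) opprK.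
Qed.

(** Both sides express on which side of [J] the crossing [x] lies: on the left read along [m]
    starting from [y], on the right along [I] starting from [u]. *)
Lemma triangle_side D c r arcs m I J x y u (v : R) : tangle_in D c r arcs ->
  m \in arcs -> I \in arcs -> J \in arcs ->
  disjoint_arcs m I -> disjoint_arcs m J -> disjoint_arcs I J ->
  straight D I -> straight D J ->
  crossings_between D m I [:: x] -> crossings_between D m J [:: y] ->
  on_arc I u -> on_arc J v -> D u = D v ->
  sgz (x.1 - y.1) * flat_sign D y.2 y.1 = sgz (x.2 - u) * flat_sign D v u.
Proof.
move=> T mA IA JA mI mJ IJ [p [a DI]] [q [b DJ]] X Y Iu Jv uv.
case: x X => x1 x2 X; have [mx1 Ix2 [_ x12]] := crossings_meet mI X (mem_head _ _).
rewrite -(flat_sign_crossing T mA JA mJ DJ Y (on_arcW mx1)) /= x12.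
rewrite /flat_sign (straight_tangent DI Iu) (straight_tangent DJ Jv) -sgzM.
congr sgz; have := line_side_straight DJ (on_arcW Jv); rewrite -uv.
rewrite (DI _ (on_arcW Iu)) (DI _ (on_arcW Ix2)) /line_side /det2 /= /GRing.scale /=.
lra.
Qed.

Lemma sqr_flat_sign D s t : self_meets D s t -> flat_sign D s t ^+ 2 = 1.
Proof.
move=> st; rewrite /flat_sign; have := transverse st.
by case: (ltrgtP (det2 (tangent D s) (tangent D t)) 0) => // H _;
  rewrite ?(ltr0_sgz H) ?(gtr0_sgz H); ring.
Qed.

Lemma no_self_crossing D m s t : self_crossings D m [::] ->
  self_meets D s t -> on_arc m s -> on_arc m t -> False.
Proof. by move=> X st ms mt; have := self_crossings_cover X st ms mt. Qed.

Lemma no_self_crossing_straight D I s t : straight D I ->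
  self_meets D s t -> on_arc I s -> on_arc I t -> False.
Proof.
move=> [p [v DI]] [/eqP neq eq] Is It; apply: neq.
exact: straight_inj DI (on_arcW Is) (on_arcW It) eq.
Qed.

End Chords.

(** * Bigon moves and the rigid vertex twist *)

Section BigonMoves.
Variable R : realType.
Implicit Types (D : diagram R) (c I J m x y p q v : R * R) (r s t w : R).
Implicit Types (arcs L : seq (R * R)).

Lemma on_disjoint_arcs I J s t : disjoint_arcs I J -> on_arc I s -> on_arc J t -> s != t.
Proof.
move=> IJ Is Jt; apply: contraTneq Jt => <-; exact: disjoint_off IJ (on_arcW Is).
Qed.

Lemma outside_linking D c r arcs I J x x' : tangle_in D c r arcs ->
  I \in arcs -> J \in arcs ->
  on_arc I x.1 -> on_arc I x'.1 -> on_arc J x.2 -> on_arc J x'.2 ->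
  {in outside D arcs, forall y, linking x y = linking x' y}.
Proof.
case: x x' => [s t] [s' t'] T IA JA Is Is' Jt Jt' y.
rewrite mem_filter => /andP[/andP[/allP o1 /allP o2] _].
by rewrite (linking_arcs Is Is' Jt Jt') ?o1 ?o2.
Qed.

Lemma outside_linking_sum D c r arcs I J x x' : tangle_in D c r arcs ->
  I \in arcs -> J \in arcs ->
  on_arc I x.1 -> on_arc I x'.1 -> on_arc J x.2 -> on_arc J x'.2 ->
  \sum_(z <- outside D arcs) charge D z * linking z x =
  \sum_(z <- outside D arcs) charge D z * linking z x'.
Proof.
move=> T IA JA Is Is' Jt Jt'; apply: eq_big_seq => z zO; congr (_ * _).
rewrite linkingC [RHS]linkingC; congr (- _).
exact: (outside_linking T IA JA Is Is' Jt Jt' zO).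
Qed.

Lemma tangle_disjoint2 D c r m I : tangle_in D c r [:: m; I] -> disjoint_arcs m I.
Proof. by case=> [[_ _ /=]]; rewrite !andbT. Qed.

Lemma listing_bigon D c r m I L : tangle_in D c r [:: m; I] -> straight D I ->
  self_crossings D m [::] -> crossings_between D m I L -> uniq L ->
  listing D (L ++ outside D [:: m; I]).
Proof.
move=> T SI Xm X uL; have mI := tangle_disjoint2 T.
apply: (listing_local T) => // [[s t]|[s t]|s t st].
- case/(crossings_meet mI X) => ms _ st; split=> //.
  by apply: on_off_arcs ms; rewrite mem_head.
- case/(crossings_meet mI X) => ms It _; apply/negP.
  case/(crossings_meet mI X) => mt _ _.
  by have := on_disjoint_arcs mI mt It; rewrite eqxx.
move=> /off_arcsP[K]; rewrite !inE => /orP[]/eqP-> sK;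
  move=> /off_arcsP[K']; rewrite !inE => /orP[]/eqP-> tK'.
- by case: (no_self_crossing Xm st sK tK').
- by apply/orP; left; apply/X; case: st.
- by apply/orP; right; apply/X; case: st.
- by case: (no_self_crossing_straight SI st sK tK').
Qed.

(** The two crossings have opposite flat signs and equal marks, hence opposite charges and weights.
    Their effects on outer indices cancel, and so do their own terms because their indices agree. *)
Lemma bigon_invariance f (ok : pred kind) D D' : bigon_move ok D D' ->
  (forall k, ok k -> virtual k || classical k) ->
  index_extension f D = index_extension f D'.
Proof.
case=> [c [r [m [I [s1 [t1 [s2 [t2 [LC [Xm Xm'] [lt12 X] X' [mE okm]]]]]]]]]] okE.
have {okE}okm := okE _ okm.
have T := local_tangle LC; have T' := local_tangle' LC; have mI := tangle_disjoint2 T.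
have mA : m \in [:: m; I] by rewrite mem_head.
have IA : I \in [:: m; I] by rewrite !inE eqxx orbT.
have SI : straight D I by case: (LC) => _ _ S _ _; apply: S; rewrite mem_head.
have SI' : straight D' I.
  have [p [v DI]] := SI; exists p, v => t tI; rewrite -DI //; apply/esym.
  by apply: (local_eq LC); apply: disjoint_off tI; rewrite disjoint_arcsC.
have [ms1 It1 st1] := crossings_meet mI X (mem_head _ _).
have [ms2 It2 st2] : [/\ on_arc m s2, on_arc I t2 & self_meets D s2 t2].
  by apply: (crossings_meet mI X); rewrite !inE eqxx orbT.
have uL : uniq [:: (s1, t1); (s2, t2)].
  by rewrite /= inE xpair_eqE andbT negb_and (lt_eqF lt12).
have flatE := bigon_flat_sign T mA IA mI SI X (negbT (lt_eqF lt12)).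
have chargeE : charge D (s2, t2) = - charge D (s1, t1).
  by rewrite /charge /= -mE flatE; case: classical; rewrite ?oppr0.
apply: (local_change_invariance LC (listing_bigon T SI Xm X uL)
  (listing_bigon T' SI' Xm' X' isT)).
- by rewrite /= -mE; case: mark okm.
- move=> y yO; rewrite !big_cons !big_nil chargeE.
  rewrite (outside_linking T mA IA (x := (s1, t1)) (x' := (s2, t2)) _ _ _ _ yO) //.
  by ring.
rewrite [RHS]big_nil [LHS]big_cons big_seq1.
have -> : weight (num_singular D) D (s2, t2) = - weight (num_singular D) D (s1, t1).
  case: (num_singular D) => [|[|n]] //=.
    by rewrite /sgn -mE !(flat_signC D s1) !(flat_signC D s2) flatE; case: mark;
      rewrite ?oppr0.
  by rewrite -mE; case: mark okm.
(* Equality of the two indices: the outer contributions agree, and in the mutual ones both the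
   charge and the linking number change sign. *)
rewrite -[X in absz X](_ : \sum_(x <- [:: (s1, t1); (s2, t2)] ++ outside D [:: m; I])
   charge D x * linking x (s2, t2) = _); first by rewrite scaleNr subrr.
rewrite !big_cat /= !big_cons !big_nil chargeE !linkingxx (linkingC (s2, t2)).
by rewrite (outside_linking_sum T mA IA (x := (s1, t1)) (x' := (s2, t2))) //; ring.
Qed.

(** The singular point and the crossing change places. The index of the singular point is kept,
    since the charge of the crossing and its linking number with the singular point both change
    sign. *)
Lemma vertex_twist_invariance f D D' : vertex_twist D D' ->
  index_extension f D = index_extension f D'.
Proof.
case=> [c [r [m [I [s1 [t1 [s2 [t2 [[DE [T SI] Xm X mE] [m1 m2 m1' m2']]]]]]]]]].
have {}DE : D = D' :> (R -> R * R) by apply/funext.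
have [T' SI'] : tangle_in D' c r [:: m; I] /\ straight D' I.
  by move: T SI; rewrite /tangle_in /straight DE.
have [Xm' X'] : self_crossings D' m [::] /\
  crossings_between D' m I [:: (s1, t1); (s2, t2)].
  by move: Xm X; rewrite /self_crossings /crossings_between DE.
have mI := tangle_disjoint2 T.
have mA : m \in [:: m; I] by rewrite mem_head.
have IA : I \in [:: m; I] by rewrite !inE eqxx orbT.
have [ms1 It1 st1] := crossings_meet mI X (mem_head _ _).
have [ms2 It2 st2] : [/\ on_arc m s2, on_arc I t2 & self_meets D s2 t2].
  by apply: (crossings_meet mI X); rewrite !inE eqxx orbT.
have neq12 : s1 != s2.
  apply/eqP => s12; subst s2; have [_ triple _] := curve_generic D.
  by move: m2; rewrite -(triple _ _ _ (self_meets_sym st1) st2) m1.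
have uL : uniq [:: (s1, t1); (s2, t2)] by rewrite /= inE xpair_eqE andbT negb_and neq12.
have flatE := bigon_flat_sign T mA IA mI SI X neq12.
have flat_eq s t : flat_sign D' s t = flat_sign D s t by rewrite /flat_sign -DE.
have HL := listing_bigon T SI Xm X uL.
have HL' := listing_bigon T' SI' Xm' X' uL.
have OE : outside D' [:: m; I] = outside D [:: m; I].
  by rewrite /outside /dps /double_points -DE.
rewrite OE in HL'.
have n1 : num_singular D =
    (1 + count (fun x => singular (mark D x.1 x.2)) (outside D [:: m; I]))%N.
  by rewrite (singular_listing HL) /= m1; case: mark m2.
have O_eq x : x \in outside D [:: m; I] ->
    mark D x.1 x.2 = mark D' x.1 x.2 /\ flat_sign D x.1 x.2 = flat_sign D' x.1 x.2.
  rewrite mem_filter => /andP[/andP[of1 of2] xD]; split; last first.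
    by rewrite flat_eq.
  have [_ meets _ _] := listing_dps D; apply: mE; first exact: meets.
  case: (T) => _ [cl _ _] /cl[J JA xJ].
  have := tangle_meet_on T JA xJ (meets _ xD).
  by move/allP: of1 => /(_ J JA) /negbTE->.
apply: (local_invariance HL HL') => //.
- by rewrite /= m1 m1' m2'; case: mark m2.
(* Outer indices may change here, but outer points have no weight: a nonsingular one because the
   diagram is singular, a singular one because it is at least the second singular point. *)
- move=> y yO; have [E|sy] := boolP (singular (mark D y.1 y.2)).
    suff : (0 < count (fun x => singular (mark D x.1 x.2)) (outside D [:: m; I]))%N.
      by rewrite n1; case: count => // n; rewrite /weight eqxx.
    by rewrite -has_count; apply/hasP; exists y.
  by rewrite n1 /weight /= (negbTE sy); case: count; rewrite ?eqxx.
have c1 : charge D (s1, t1) = 0 by rewrite /charge /= m1.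
have c2 : charge D' (s2, t2) = 0 by rewrite /charge /= m2'.
have c3 : charge D' (s1, t1) = - charge D (s2, t2).
  by rewrite /charge /= m1' flat_eq flatE; case: mark m2 => //= _; rewrite opprK.
rewrite n1; case: count => [|n]; last first.
  by rewrite !big_cons !big_nil /= !scale0r !addr0.
rewrite !(big_cons, big_nil) /= m1 m2' m1' /= (_ : singular (mark D s2 t2) = false); last first.
  by case: mark m2.
rewrite (_ : singular (flip (mark D s2 t2)) = false); last by case: mark m2.
rewrite !scale0r !addr0 add0r; congr (_ *: index_term f (absz _)).
rewrite !linkingxx (linkingC (s2, t2)) c1 c2 c3.
have OD : \sum_(z <- outside D [:: m; I]) charge D' z * linking z (s2, t2) =
          \sum_(z <- outside D [:: m; I]) charge D z * linking z (s2, t2).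
  by apply: eq_big_seq => z zO; have [mzE fzE] := O_eq _ zO; rewrite /charge mzE fzE.
rewrite OD (outside_linking_sum T mA IA (x := (s1, t1)) (x' := (s2, t2))) //; ring.
Qed.
End BigonMoves.

(** * Triangle moves *)

Section TriangleMoves.
Variable R : realType.
Implicit Types (D : diagram R) (c I J m x y p q : R * R) (r s t u v w : R).
Implicit Types (arcs L : seq (R * R)).

Lemma sgz_disjoint_arcs I J s s' t t' : disjoint_arcs I J ->
  on_arc I s -> on_arc I s' -> on_arc J t -> on_arc J t' ->
  sgz (s - t) = sgz (s' - t').
Proof.
move=> IJ Is Is' Jt Jt'; rewrite (sgz_off_arcr Is Is').
  by rewrite (sgz_off_arc Jt Jt') // (disjoint_off IJ) ?on_arcW.
by rewrite disjoint_arcsC in IJ; rewrite (disjoint_off IJ) ?on_arcW.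
Qed.

Lemma tangle_disjoint3 D c r m I J : tangle_in D c r [:: m; I; J] ->
  [/\ disjoint_arcs m I, disjoint_arcs m J & disjoint_arcs I J].
Proof. by case=> [[_ _ /=]]; rewrite !andbT => /andP[/andP[mI mJ] IJ]. Qed.

(* The contributions to the indices of x, y and (u, v), respectively, that depend
   on the order of two crossings along one arc. *)
Definition triangle_balanced (a b e : int) x y u v :=
  [/\ b * sgz (x.1 - y.1) = e * sgz (x.2 - u),
      a * sgz (y.1 - x.1) + e * sgz (y.2 - v) = 0
    & a * sgz (u - x.2) = b * sgz (v - y.2)].

(** [triangle_side], applied with each of the two chords in the role of [I], gives the first two
    identities. The third follows by elimination, as the square of a flat sign is 1. *)
Lemma triangle_balance D c r arcs m I J x y u v : tangle_in D c r arcs ->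
  m \in arcs -> I \in arcs -> J \in arcs ->
  disjoint_arcs m I -> disjoint_arcs m J -> disjoint_arcs I J ->
  straight D I -> straight D J ->
  crossings_between D m I [:: x] -> crossings_between D m J [:: y] ->
  on_arc I u -> on_arc J v -> self_meets D u v ->
  triangle_balanced (flat_sign D x.1 x.2) (flat_sign D y.1 y.2) (flat_sign D u v)
    x y u v.
Proof.
move=> T mA IA JA mI mJ IJ SI SJ X Y Iu Jv uv; have [_ Duv] := uv.
have := triangle_side T mA IA JA mI mJ IJ SI SJ X Y Iu Jv Duv.
have JI : disjoint_arcs J I by rewrite disjoint_arcsC.
have := triangle_side T mA JA IA mJ mI JI SJ SI Y X Jv Iu (esym Duv).
rewrite (flat_signC D x.1) (flat_signC D y.1) (flat_signC D u).
have := sqr_flat_sign uv; rewrite /triangle_balanced -(opprB x.2 u) -(opprB y.2 v) -(opprB x.1 y.1) !sgzN.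
set a := flat_sign D x.1 _; set b := flat_sign D y.1 _; set e := flat_sign D u v.
set A := sgz (y.2 - v); set B := sgz (x.1 - y.1); set C := sgz (x.2 - u).
move=> e2 E2 E1; have {}E1 : b * B = e * C by lia.
have {}E2 : a * B = e * A by lia.
split; [exact: E1|lia|]; rewrite !mulrN; congr (- _).
have -> : C = e * (b * B) by rewrite E1 mulrA -expr2 e2 mul1r.
have -> : A = e * (a * B) by rewrite E2 mulrA -expr2 e2 mul1r.
by ring.
Qed.

(** Each linking number is a sum of four signs. Those comparing parameters on different arcs are the
    same before and after the move; those comparing parameters on one arc cancel by
    [triangle_balanced]. *)
Lemma triangle_linking (a b e : int) m I J x y x' y' u v :
  disjoint_arcs m I -> disjoint_arcs m J -> disjoint_arcs I J ->
  on_arc m x.1 -> on_arc I x.2 -> on_arc m x'.1 -> on_arc I x'.2 ->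
  on_arc m y.1 -> on_arc J y.2 -> on_arc m y'.1 -> on_arc J y'.2 ->
  on_arc I u -> on_arc J v ->
  triangle_balanced a b e x y u v -> triangle_balanced a b e x' y' u v ->
  [/\ b * linking y x + e * linking (u, v) x =
        b * linking y' x' + e * linking (u, v) x',
      a * linking x y + e * linking (u, v) y =
        a * linking x' y' + e * linking (u, v) y'
    & a * linking x (u, v) + b * linking y (u, v) =
        a * linking x' (u, v) + b * linking y' (u, v)].
Proof.
move=> mI mJ IJ mx Ix mx' Ix' my Jy my' Jy' Iu Jv [i1 /addr0_eq i2 i3] [j1 /addr0_eq j2 j3].
have Im := mI; have Jm := mJ; have JI := IJ; rewrite disjoint_arcsC in Im Jm JI.
rewrite disjoint_arcsC in Jm; rewrite disjoint_arcsC in JI.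
rewrite /linking /=; split.
- rewrite (sgz_disjoint_arcs mJ mx mx' Jy Jy') (sgz_disjoint_arcs Im Ix Ix' my my').
  rewrite (sgz_disjoint_arcs IJ Ix Ix' Jy Jy') (sgz_disjoint_arcs mI mx mx' Iu Iu).
  rewrite (sgz_disjoint_arcs mJ mx mx' Jv Jv) (sgz_disjoint_arcs IJ Ix Ix' Jv Jv).
  by rewrite !(mulrDr, mulrN) i1 j1; ring.
- rewrite (sgz_disjoint_arcs mI my my' Ix Ix') (sgz_disjoint_arcs Jm Jy Jy' mx mx').
  rewrite (sgz_disjoint_arcs JI Jy Jy' Ix Ix') (sgz_disjoint_arcs mI my my' Iu Iu).
  rewrite (sgz_disjoint_arcs mJ my my' Jv Jv) (sgz_disjoint_arcs JI Jy Jy' Iu Iu).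
  by rewrite !(mulrDr, mulrN) -i2 -j2; ring.
rewrite (sgz_disjoint_arcs Im Iu Iu mx mx') (sgz_disjoint_arcs Jm Jv Jv mx mx').
rewrite (sgz_disjoint_arcs JI Jv Jv Ix Ix') (sgz_disjoint_arcs Im Iu Iu my my').
rewrite (sgz_disjoint_arcs IJ Iu Iu Jy Jy') (sgz_disjoint_arcs Jm Jv Jv my my').
by rewrite !(mulrDr, mulrN) i3 j3; ring.
Qed.

Lemma listing_triangle D c r m I J x y u v : tangle_in D c r [:: m; I; J] ->
  straight D I -> straight D J -> self_crossings D m [::] ->
  crossings_between D m I [:: x] -> crossings_between D m J [:: y] ->
  crossings_between D I J [:: (u, v)] ->
  listing D ([:: x; y; (u, v)] ++ outside D [:: m; I; J]).
Proof.
move=> T SI SJ Xm X Y U; have [mI mJ IJ] := tangle_disjoint3 T.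
have [mx Ix xx] : [/\ on_arc m x.1, on_arc I x.2 & self_meets D x.1 x.2].
  by apply: (crossings_meet mI X); rewrite -surjective_pairing mem_head.
have [my Jy yy] : [/\ on_arc m y.1, on_arc J y.2 & self_meets D y.1 y.2].
  by apply: (crossings_meet mJ Y); rewrite -surjective_pairing mem_head.
have [Iu Jv uv] := crossings_meet IJ U (mem_head _ _).
have nx1 : x.1 != u := on_disjoint_arcs mI mx Iu.
have nx2 : x.2 != y.2 := on_disjoint_arcs IJ Ix Jy.
have ny1 : y.1 != u := on_disjoint_arcs mI my Iu.
have nx3 : x.1 != x.2 := on_disjoint_arcs mI mx Ix.
have ny3 : y.1 != y.2 := on_disjoint_arcs mJ my Jy.
have nu3 : u != v := on_disjoint_arcs IJ Iu Jv.
have nxy : x.1 != y.2 := on_disjoint_arcs mJ mx Jy.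
have nyx : y.1 != x.2 := on_disjoint_arcs mI my Ix.
have nxv : x.1 != v := on_disjoint_arcs mJ mx Jv.
have nyv : y.1 != v := on_disjoint_arcs mJ my Jv.
apply: (listing_local T).
- rewrite /= !inE [x]surjective_pairing [y]surjective_pairing !xpair_eqE.
  by rewrite (negbTE nx1) (negbTE nx2) (negbTE ny1) !andbF.
- move=> z; rewrite !inE => /or3P[] /eqP->; split=> //.
  + by apply: on_off_arcs mx; rewrite mem_head.
  + by apply: on_off_arcs my; rewrite mem_head.
  + by apply: on_off_arcs Iu; rewrite !inE eqxx orbT.
- move=> z; rewrite !inE [x]surjective_pairing [y]surjective_pairing !xpair_eqE /=.
  by case/or3P=> /eqP-> /=; rewrite ?(eq_sym v) ?(eq_sym y.2) ?(eq_sym x.2)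
    ?(negbTE nx1) ?(negbTE nx3) ?(negbTE ny3) ?(negbTE nu3) ?(negbTE nxy)
    ?(negbTE nyx) ?(negbTE nxv) ?(negbTE nyv) ?(negbTE ny1) ?andbF.
move=> s t st; have [_ eq] := st.
have inX a b : on_arc m a -> on_arc I b -> D a = D b -> (a, b) \in [:: x; y; (u, v)].
  move=> ma Ib ab; have /X : [/\ on_arc m a, on_arc I b & D a = D b] by [].
  by rewrite !inE => ->.
have inY a b : on_arc m a -> on_arc J b -> D a = D b -> (a, b) \in [:: x; y; (u, v)].
  move=> ma Jb ab; have /Y : [/\ on_arc m a, on_arc J b & D a = D b] by [].
  by rewrite !inE => ->; rewrite orbT.
have inU a b : on_arc I a -> on_arc J b -> D a = D b -> (a, b) \in [:: x; y; (u, v)].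
  move=> Ia Jb ab; have /U : [/\ on_arc I a, on_arc J b & D a = D b] by [].
  by rewrite !inE => ->; rewrite !orbT.
have arcE K : K \in [:: m; I; J] -> [\/ K = m, K = I | K = J].
  by rewrite !inE => /or3P[]/eqP->; constructor.
move=> /off_arcsP[K /arcE[]-> sK] /off_arcsP[K' /arcE[]-> tK'].
- by case: (no_self_crossing Xm st sK tK').
- by rewrite inX.
- by rewrite inY.
- by rewrite orbC inX.
- by case: (no_self_crossing_straight SI st sK tK').
- by rewrite inU.
- by rewrite orbC inY.
- by rewrite orbC inU.
- by case: (no_self_crossing_straight SJ st sK tK').
Qed.

Lemma triangle_invariance f (ok : kind -> kind -> bool) D D' :
  triangle_move ok D D' ->
  (forall k l, ok k l -> virtual k || classical k && (classical l || singular l)) ->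
  index_extension f D = index_extension f D'.
Proof.
case=> [c [r [m [I [J [u [v [x [y [x' [y' [k H]]]]]]]]]]]] okE.
case: H => [[LC [Xm Xm'] U [X Y] [X' Y']] [[mx my] [mx' my'] okm]].
have {okE}okm := okE _ _ okm.
have T := local_tangle LC; have T' := local_tangle' LC.
have [mI mJ IJ] := tangle_disjoint3 T.
set arcs := [:: m; I; J] in T T'.
have mA : m \in arcs by rewrite mem_head.
have IA : I \in arcs by rewrite !inE eqxx orbT.
have JA : J \in arcs by rewrite !inE eqxx !orbT.
have offI t : I.1 <= t <= I.2 -> ~~ on_arc m t.
  by apply: disjoint_off; rewrite disjoint_arcsC.
have offJ t : J.1 <= t <= J.2 -> ~~ on_arc m t.
  by apply: disjoint_off; rewrite disjoint_arcsC.
have SI : straight D I by case: (LC) => _ _ S _ _; apply: S; rewrite mem_head.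
have SJ : straight D J by case: (LC) => _ _ S _ _; apply: S; rewrite !inE eqxx orbT.
have SI' : straight D' I.
  have [p [a DI]] := SI; exists p, a => t tI; rewrite -DI //; apply/esym.
  by apply: (local_eq LC); apply: offI.
have SJ' : straight D' J.
  have [p [a DJ]] := SJ; exists p, a => t tJ; rewrite -DJ //; apply/esym.
  by apply: (local_eq LC); apply: offJ.
have [Iu Jv uv] := crossings_meet IJ U (mem_head _ _).
have U' : crossings_between D' I J [:: (u, v)].
  move=> s t; split=> [[Is Jt eq]|/U[Is Jt eq]].
    apply/U; split=> //.
    by rewrite (local_eq LC (offI _ (on_arcW Is))) (local_eq LC (offJ _ (on_arcW Jt))).
  split=> //.
  by rewrite -(local_eq LC (offI _ (on_arcW Is))) -(local_eq LC (offJ _ (on_arcW Jt))).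
have uv' : self_meets D' u v by case: (crossings_meet IJ U' (mem_head _ _)).
have mu := offI _ (on_arcW Iu); have mv := offJ _ (on_arcW Jv).
have [mx1 Ix2 xx] : [/\ on_arc m x.1, on_arc I x.2 & self_meets D x.1 x.2].
  by apply: (crossings_meet mI X); rewrite -surjective_pairing mem_head.
have [my1 Jy2 yy] : [/\ on_arc m y.1, on_arc J y.2 & self_meets D y.1 y.2].
  by apply: (crossings_meet mJ Y); rewrite -surjective_pairing mem_head.
have [mx1' Ix2' xx'] : [/\ on_arc m x'.1, on_arc I x'.2 & self_meets D' x'.1 x'.2].
  by apply: (crossings_meet mI X'); rewrite -surjective_pairing mem_head.
have [my1' Jy2' yy'] : [/\ on_arc m y'.1, on_arc J y'.2 & self_meets D' y'.1 y'.2].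
  by apply: (crossings_meet mJ Y'); rewrite -surjective_pairing mem_head.
have mend : m.1 <= m.2 <= m.2 by rewrite lexx (ltW (tangle_lt T mA)).
have Dend : D m.2 = D' m.2 by apply: (local_eq LC); rewrite /on_arc ltxx andbF.
(* The sign is read off at the end [m.2] of the moving arc, a point common to both diagrams. *)
have flat_move K z z' : K \in arcs -> disjoint_arcs m K -> straight D K -> 
    (forall t, K.1 <= t <= K.2 -> ~~ on_arc m t) -> on_arc m z.1 -> on_arc m z'.1 ->
    crossings_between D m K [:: z] -> crossings_between D' m K [:: z'] ->
    flat_sign D' z'.1 z'.2 = flat_sign D z.1 z.2.
  move=> KA mK [p [a DK]] offK mz mz' Z Z'.
  have DK' : straight_along D' p a K.
    by move=> t tK; rewrite -(local_eq LC) ?offK // DK.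
  have := flat_sign_crossing T mA KA mK DK Z mend.
  rewrite Dend (flat_sign_crossing T' mA KA mK DK' Z' mend).
  have [_ mz2] := andP mz; have [_ mz2'] := andP mz'.
  rewrite !gtr0_sgz ?subr_gt0 // !mul1r.
  by rewrite (flat_signC D z.1) (flat_signC D' z'.1) => /oppr_inj.
have flatx := flat_move I x x' IA mI SI offI mx1 mx1' X X'.
have flaty := flat_move J y y' JA mJ SJ offJ my1 my1' Y Y'.
have flatu : flat_sign D' u v = flat_sign D u v.
  exact/esym/(local_flat_sign LC uv mu mv).
have marku : mark D' u v = mark D u v by exact/esym/(local_mark LC uv mu mv).
have chargex : charge D' x' = charge D x by rewrite /charge mx mx' flatx.
have chargey : charge D' y' = charge D y by rewrite /charge my my' flaty.
have chargeu : charge D' (u, v) = charge D (u, v) by rewrite /charge /= marku flatu.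
have weightE n z z' : mark D' z'.1 z'.2 = mark D z.1 z.2 ->
    flat_sign D' z'.1 z'.2 = flat_sign D z.1 z.2 -> weight n D' z' = weight n D z.
  move=> mzE fzE; rewrite /weight mzE; case: n => [|[|n]] //.
  by rewrite /sgn mzE (flat_signC D' z'.1) (flat_signC D z.1) fzE.
have HL := listing_triangle T SI SJ Xm X Y U.
have HL' := listing_triangle T' SI' SJ' Xm' X' Y' U'.
have bal := triangle_balance T mA IA JA mI mJ IJ SI SJ X Y Iu Jv uv.
have bal' := triangle_balance T' mA IA JA mI mJ IJ SI' SJ' X' Y' Iu Jv uv'.
rewrite flatx flaty flatu in bal'.
have [lx ly lu] := triangle_linking mI mJ IJ mx1 Ix2 mx1' Ix2' my1 Jy2 my1' Jy2'
  Iu Jv bal bal'.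
apply: (local_change_invariance LC HL HL').
- by rewrite /= mx mx' my my' marku.
- move=> z zO; rewrite !big_cons !big_nil chargex chargey chargeu.
  rewrite (outside_linking T mA IA (x := x) (x' := x') _ _ _ _ zO) //.
  by rewrite (outside_linking T mA JA (x := y) (x' := y') _ _ _ _ zO).
rewrite !big_cons !big_nil (weightE _ x x') ?(weightE _ y y') ?(weightE _ (u, v) (u, v))
  ?mx' ?my' //.
have charge_outside z :
    \sum_(w <- outside D (m :: [:: I; J])) charge D' w * linking w z =
    \sum_(w <- outside D arcs) charge D w * linking w z.
  apply: eq_big_seq => w wO; rewrite /charge.
  by have [-> ->] := outside_eq LC wO.
have n_gt0 : singular (mark D u v) -> (0 < num_singular D)%N.
  by rewrite (singular_listing HL) /= => ->; rewrite !addnA addnAC addn1.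
rewrite !linkingxx !charge_outside chargex chargey chargeu.
rewrite (outside_linking_sum T mA IA (x := x) (x' := x')) //.
rewrite (outside_linking_sum T mA JA (x := y) (x' := y')) //.
(* If the moving arc is virtual, [x] and [y] have neither weight nor charge, and the index of (u, v)
   receives only outer contributions. *)
case/orP: okm => [kv|/andP[kc ul]].
  have wx : weight (num_singular D) D x = 0 by rewrite weight_virtual ?mx.
  have wy : weight (num_singular D) D y = 0 by rewrite weight_virtual ?my.
  have cx : charge D x = 0 by rewrite /charge mx; case: (k) kv.
  have cy : charge D y = 0 by rewrite /charge my; case: (k) kv.
  by rewrite wx wy cx cy !scale0r !mul0r.
have cx : charge D x = flat_sign D x.1 x.2 by rewrite /charge mx kc.
have cy : charge D y = flat_sign D y.1 y.2 by rewrite /charge my kc.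
rewrite cx cy !mulr0 !add0r.
rewrite 2!(addrA (_ * linking _ (u, v)) (_ * linking _ (u, v))) lu.
case/orP: ul => [lc|ls].
  have cu : charge D (u, v) = flat_sign D u v by rewrite /charge /= lc.
  rewrite cu !(addrA (_ * linking _ y)) !(addrA (_ * linking _ y')) ly.
  by rewrite !(addrA (_ * linking _ x)) !(addrA (_ * linking _ x')) lx.
(* With a singular point present, the classical crossings [x] and [y] weigh nothing, so among the
   three only the index of the singular point has to be preserved. *)
have := n_gt0 ls; case: (num_singular D) => // n _.
have wx : weight n.+1 D x = 0.
  by rewrite /weight mx; case: (n) => //; case: (k) kc.
have wy : weight n.+1 D y = 0.
  by rewrite /weight my; case: (n) => //; case: (k) kc.
by rewrite wx wy !scale0r.
Qed.
End TriangleMoves.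

(** * Planar isotopy *)

Section Isotopy.
Variable R : realType.
Implicit Types (D : diagram R) (x y p v w : R * R) (r s t : R) (h : R -> R).

Lemma line_diffeo_mono h : line_diffeo h -> {mono h : s t / s <= t}.
Proof.
move=> [dh _ h0 _]; apply: le_mono => s t st.
have hc u : {for u, continuous h}.
  by apply: differentiable_continuous; apply/derivable1_diffP.
apply: (@gtr0_derive1_lt_cc _ h s t) => //; rewrite ?in_itv /= ?lexx ?ltW //.
exact: continuous_subspaceT.
Qed.

Lemma line_diffeo_surj h t : line_diffeo h -> exists s, h s = t.
Proof.
(* [M] is at least the absolute values of [t] and [r], so [h] fixes both ends of the interval from
   -M to M, and the intermediate value theorem applies on it. *)
move=> [dh _ _ [r hr]]; pose M := `|t| + `|r|.
have tM : - M <= t <= M by rewrite -ler_norml /M lerDl.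
have M0 : 0 <= M by rewrite addr_ge0.
have rM : r <= `|M| by rewrite ger0_norm // (le_trans (ler_norm _)) // lerDr.
have hM : h M = M by exact: hr.
have hNM : h (- M) = - M by apply: hr; rewrite normrN.
have hc : continuous h.
  by move=> u; apply: differentiable_continuous; apply/derivable1_diffP.
have [||s _ <-] := @IVT _ h (- M) M t _ (continuous_subspaceT hc).
- by lra.
- by rewrite hM hNM min_l ?max_r //; lra.
by exists s.
Qed.

(** Identifies the componentwise velocity with the differential, so that the chain rule applies to
    an isotopy. *)
Lemma tangentE D t :
  differentiable D t /\ tangent D t = 'd (D : R -> R * R) t 1.
Proof.
have [dD _ _ _] := curve_immersion D; have [/derivable1_diffP d1 /derivable1_diffP d2] := dD t.
have DE : (D : R -> R * R) = (fun s => ((D s).1, (D s).2)).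
  by apply/funext => s; case: (D s).
split; first by rewrite DE; apply: differentiable_pair.
by rewrite /tangent !derive1E !deriveE // [in RHS]DE diff_pair.
Qed.

Lemma det2_linear (L : R * R -> R * R) v w :
  (forall (a b : R) p q, L (a *: p + b *: q) = a *: L p + b *: L q) ->
  det2 (L v) (L w) = det2 (L (1, 0)) (L (0, 1)) * det2 v w.
Proof.
move=> lin; have LE u : L u = u.1 *: L (1, 0) + u.2 *: L (0, 1).
  rewrite -lin; congr (L _); case: u => a b.
  by congr (_, _) => /=; rewrite /GRing.scale /= ?mulr1 ?mulr0 ?addr0 ?add0r.
rewrite (LE v) (LE w); case: (L (1, 0)) (L (0, 1)) => [a b] [c d].
by rewrite /det2 /= /GRing.scale /=; ring.
Qed.

Lemma det2_scale r s v w : det2 (r *: v) (s *: w) = r * s * det2 v w.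
Proof. by rewrite /det2 /= /GRing.scale /=; ring. Qed.

(** At a double point both velocities are mapped by the same differential of [phi] and scaled by
    positive speeds of [h]; the Jacobian is positive. *)
Lemma isotopic_flat_sign D D' phi h s t : plane_diffeo phi -> line_diffeo h ->
  (forall t, D' t = phi (D (h t))) -> D (h s) = D (h t) ->
  flat_sign D' s t = flat_sign D (h s) (h t).
Proof.
move=> [_ dphi _ phi0 _] [dh _ h0 _] D'E eq.
have tangent' u : tangent D' u = derive1 h u *: 'd phi (D (h u)) (tangent D (h u)).
  have [_ ->] := tangentE D' u; have [dD ->] := tangentE D (h u).
  have du : differentiable h u by apply/derivable1_diffP.
  have dDh : differentiable ((D : R -> R * R) \o h) u by apply: differentiable_comp.
  have E1 := diff_comp dDh (dphi (D (h u))).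
  have E2 := diff_comp du dD.
  have -> : (D' : R -> R * R) = phi \o ((D : R -> R * R) \o h).
    by apply/funext => w; rewrite D'E.
  transitivity ('d phi (D (h u)) ('d ((D : R -> R * R) \o h) u 1)).
    exact: (congr1 (fun k => k 1) E1).
  transitivity ('d phi (D (h u)) ('d (D : R -> R * R) (h u) ('d h u 1))).
    congr ('d phi _ _); exact: (congr1 (fun k => k 1) E2).
  rewrite derive1E (deriveE _ du) -!linearZ; congr ('d phi _ _); congr ('d _ _ _).
  by rewrite /GRing.scale /= mulr1.
have lin a b p q : 'd phi (D (h s)) (a *: p + b *: q) =
    a *: 'd phi (D (h s)) p + b *: 'd phi (D (h s)) q by rewrite linearD !linearZ.
have := phi0 (D (h s)); rewrite !deriveE // /flat_sign !tangent' -eq.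
move: lin; move: ('d phi (D (h s)) : R * R -> R * R) => L lin det0.
by rewrite det2_scale det2_linear // !sgzM (gtr0_sgz (h0 s)) (gtr0_sgz (h0 t))
  (gtr0_sgz det0) !mul1r.
Qed.

(** Applying [h] to both parameters carries the double points of [D'] bijectively to those of [D].
    As [h] is increasing, linking numbers are kept along with marks and flat signs. *)
Lemma isotopic_invariance f D D' : isotopic D D' ->
  index_extension f D = index_extension f D'.
Proof.
move=> [phi [h [Hphi Hh D'E mE]]].
have hle := line_diffeo_mono Hh.
have hmono := leW_mono hle.
have hinj : injective h := inc_inj hle.
have phi_inj : injective phi by case: Hphi => /bij_inj.
pose hh x := (h x.1, h x.2).
have meets s t : self_meets D' s t <-> self_meets D (h s) (h t).
  rewrite /self_meets (inj_eq hinj) !D'E.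
  by split=> -[ne]; [move/phi_inj|move->].
have [uD' D'_meets D'_anti D'_cover] := listing_dps D'.
have hh_inj : injective hh by move=> [a b] [c d] [/hinj-> /hinj->].
have HL : listing D (map hh (dps D') ++ [::]).
  rewrite cats0; split.
  - by rewrite map_inj_uniq.
  - by move=> _ /mapP[x xD' ->]; apply/meets/D'_meets.
  - move=> _ /mapP[x xD' ->]; rewrite -[(_, _)]/(hh (x.2, x.1)) mem_map //.
    exact: D'_anti.
  move=> s' t'; have [s <-] := line_diffeo_surj s' Hh.
  have [t <-] := line_diffeo_surj t' Hh.
  move/meets/D'_cover; rewrite -[(h s, h t)]/(hh (s, t)) -[(h t, h s)]/(hh (t, s)).
  by rewrite !mem_map.
have HL' : listing D' (dps D' ++ [::]) by rewrite cats0; apply: listing_dps.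
have sgzh s t : sgz (h s - h t) = sgz (s - t).
  case: (ltrgtP s t) => [st|ts|->]; last by rewrite !subrr.
    by rewrite !ltr0_sgz ?subr_lt0 ?hmono.
  by rewrite !gtr0_sgz ?subr_gt0 ?hmono.
have linkE x y : linking (hh x) (hh y) = linking x y by rewrite /linking /= !sgzh.
have flatE x : x \in dps D' -> flat_sign D (hh x).1 (hh x).2 = flat_sign D' x.1 x.2.
  move/D'_meets => xx; rewrite (isotopic_flat_sign Hphi Hh D'E) //.
  by case/meets: xx.
have markE x : x \in dps D' -> mark D (hh x).1 (hh x).2 = mark D' x.1 x.2.
  by move/D'_meets => xx; rewrite mE.
have chargeE x : x \in dps D' -> charge D (hh x) = charge D' x.
  by move=> xD'; rewrite /charge flatE // markE.
have weightE n x : x \in dps D' -> weight n D (hh x) = weight n D' x.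
  move=> xD'; rewrite /weight; case: n => [|[|n]] //; last by rewrite markE.
  rewrite /sgn markE // (flat_signC D (hh x).1) (flat_signC D' x.1).
  by rewrite flatE.
apply: (local_invariance HL HL') => //.
  rewrite count_map; apply: eq_in_count => x xD' /=.
  by rewrite -[h x.1]/(hh x).1 -[h x.2]/(hh x).2 markE.
rewrite !cats0 big_map; apply: eq_big_seq => x xD'; rewrite weightE //.
congr (_ *: index_term f (absz _)); rewrite big_map; apply: eq_big_seq => y yD'.
by rewrite chargeE // linkE.
Qed.
End Isotopy.

(** * A long trefoil *)

Section Trefoil.
Variable R : realType.
Implicit Types (a s t u w : R).

(** The maximum of [u] and 0, in a form that makes continuity immediate. *)
Definition pos_part u : R := (u + `|u|) / 2.

Lemma pos_part_ge0 u : 0 <= u -> pos_part u = u.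
Proof. by move=> u0; rewrite /pos_part ger0_norm //; lra. Qed.

Lemma pos_part_le0 u : u <= 0 -> pos_part u = 0.
Proof. by move=> u0; rewrite /pos_part ler0_norm //; lra. Qed.

Lemma continuous_pos_part : continuous pos_part.
Proof.
move=> u; apply: cvgM; last exact: cvg_cst.
by apply: cvgD; [exact: cvg_id|exact: norm_continuous].
Qed.

(** At the corner 0 the difference quotient is [pos_part] itself, which is continuous and vanishes
    there. *)
Lemma is_derive_pos_part_sqr u :
  is_derive u 1 (fun w => pos_part w ^+ 2) (2 * pos_part u).
Proof.
case: (ltrgtP u 0) => [u0|u0|->].
- rewrite pos_part_le0 ?mulr0 ?ltW //.
  apply: (@near_eq_is_derive _ _ _ (cst 0)).
  have : \near u, u \in `]-oo, 0[ by apply: near_in_itvNyo; rewrite in_itv.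
  by apply: filterS => w; rewrite in_itv /= => w0; rewrite pos_part_le0 ?ltW ?expr0n.
- rewrite pos_part_ge0 ?ltW //.
  apply: (@near_eq_is_derive _ _ _ (fun w => w ^+ 2)).
    have : \near u, u \in `]0, +oo[ by apply: near_in_itvoy; rewrite in_itv /= u0.
    by apply: filterS => w; rewrite in_itv /= andbT => w0; rewrite pos_part_ge0 ?ltW.
  by apply: is_derive_eq; rewrite /GRing.scale /=; ring.
rewrite pos_part_ge0 // mulr0; apply/is_derive1_caratheodory.
exists pos_part; split; [|exact: continuous_pos_part|exact: pos_part_ge0].
move=> w; rewrite (pos_part_ge0 (lexx 0)) !subr0 expr0n subr0 /=.
have [w0|w0] := leP 0 w; first by rewrite pos_part_ge0.
by rewrite pos_part_le0 ?ltW // mul0r expr0n.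
Qed.

Definition spline a t : R := pos_part (t ^+ 2 - a) ^+ 2.

Lemma is_derive_spline a t :
  is_derive t 1 (spline a) (4 * t * pos_part (t ^+ 2 - a)).
Proof.
have H : is_derive t 1 (fun s => s ^+ 2 - a) (2 * t).
  by apply: is_derive_eq; rewrite /GRing.scale /=; ring.
have K := @is_derive1_comp _ (fun w => pos_part w ^+ 2) (fun s => s ^+ 2 - a) t _ _
  (is_derive_pos_part_sqr _) H.
by apply: (is_derive_eq K); rewrite /=; ring.
Qed.

(* A reparametrized Shastri trefoil (t^3 - 49 t, t^4 - 73 t^2) on [-9, 9], where
   the parameters -8, -7, -3, 3, 7, 8 of the double points are integers; quadratic
   splines in t^2 with nodes 81, 82, 83 bend its ends to the axis. *)
Definition trefoil_x t : R :=
  t * (4 * (t ^+ 2 - 49) - spline 81 t + spline 83 t) / 132.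
Definition trefoil_y t : R :=
  (t ^+ 4 - 73 * t ^+ 2) *
  (1 - (spline 81 t - 2 * spline 82 t + spline 83 t) / 2).

Definition trefoil_dx t : R :=
  (4 * (t ^+ 2 - 49) - spline 81 t + spline 83 t
   + 8 * t ^+ 2 - 4 * t ^+ 2 * pos_part (t ^+ 2 - 81)
   + 4 * t ^+ 2 * pos_part (t ^+ 2 - 83)) / 132.
Definition trefoil_dy t : R :=
  (4 * t ^+ 3 - 146 * t) *
    (1 - (spline 81 t - 2 * spline 82 t + spline 83 t) / 2)
  - (t ^+ 4 - 73 * t ^+ 2) * (2 * t) *
    (pos_part (t ^+ 2 - 81) - 2 * pos_part (t ^+ 2 - 82) + pos_part (t ^+ 2 - 83)).

Local Existing Instance is_derive_spline.

Lemma is_derive_trefoil_x t : is_derive t 1 trefoil_x (trefoil_dx t).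
Proof.
rewrite /trefoil_x; apply: is_derive_eq.
by rewrite /trefoil_dx /GRing.scale /=; field.
Qed.

Lemma is_derive_trefoil_y t : is_derive t 1 trefoil_y (trefoil_dy t).
Proof.
rewrite /trefoil_y; apply: is_derive_eq.
by rewrite /trefoil_dy /GRing.scale /=; field.
Qed.

Definition trefoil t : R * R := (trefoil_x t, trefoil_y t).

Lemma tangent_trefoil t : tangent trefoil t = (trefoil_dx t, trefoil_dy t).
Proof.
have dx := is_derive_trefoil_x t; have dy := is_derive_trefoil_y t.
by rewrite /tangent /trefoil /= !derive1E !derive_val.
Qed.

Lemma continuous_pos_part_sqr a : continuous (fun t => pos_part (t ^+ 2 - a)).
Proof.
move=> t; apply: (@continuous_comp _ _ _ (fun t => t ^+ 2 - a) pos_part).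
  by apply: cvgB; [exact: exprn_continuous|exact: cvg_cst].
exact: continuous_pos_part.
Qed.

Lemma continuous_spline a : continuous (spline a).
Proof.
move=> t; apply: differentiable_continuous; apply/derivable1_diffP.
by case: (is_derive_spline a t).
Qed.

Lemma continuous_add (f g : R -> R) :
  continuous f -> continuous g -> continuous (fun t => f t + g t).
Proof. by move=> fc gc t; apply: cvgD; [exact: fc|exact: gc]. Qed.

Lemma continuous_opp (f : R -> R) : continuous f -> continuous (fun t => - f t).
Proof. by move=> fc t; apply: cvgN; exact: fc. Qed.

Lemma continuous_mul (f g : R -> R) :
  continuous f -> continuous g -> continuous (fun t => f t * g t).
Proof. by move=> fc gc t; apply: cvgM; [exact: fc|exact: gc]. Qed.

Ltac continuity := lazymatch goal with
  | |- continuous (fun t => pos_part (t ^+ 2 - _)) => exact: continuous_pos_part_sqr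
  | |- continuous (fun t => spline ?a t) => exact: continuous_spline
  | |- continuous (fun t => @?f t + @?g t) =>
      apply: (@continuous_add f g); continuity
  | |- continuous (fun t => - @?f t) => apply: (@continuous_opp f); continuity
  | |- continuous (fun t => @?f t * @?g t) =>
      apply: (@continuous_mul f g); continuity
  | |- continuous (fun t => t ^+ ?n) => exact: exprn_continuous
  | |- continuous (fun t => t) => by move=> ?; exact: cvg_id
  | |- continuous (fun t => ?c) => exact: cst_continuous
  end.

Lemma continuous_trefoil_dx : continuous trefoil_dx.
Proof. rewrite /trefoil_dx; continuity. Qed.

Lemma continuous_trefoil_dy : continuous trefoil_dy.
Proof. rewrite /trefoil_dy; continuity. Qed.

Lemma spline_in a t : t ^+ 2 <= a -> spline a t = 0.
Proof. by move=> ta; rewrite /spline pos_part_le0 ?expr0n // subr_le0. Qed.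

Lemma spline_out a t : a <= t ^+ 2 -> spline a t = (t ^+ 2 - a) ^+ 2.
Proof. by move=> ta; rewrite /spline pos_part_ge0 // subr_ge0. Qed.

Lemma trefoil_inner t : t ^+ 2 <= 81 ->
  trefoil t = ((t ^+ 3 - 49 * t) / 33, t ^+ 4 - 73 * t ^+ 2).
Proof.
move=> t81; have [t82 t83] : t ^+ 2 <= 82 /\ t ^+ 2 <= 83 by lra.
rewrite /trefoil /trefoil_x /trefoil_y (spline_in t81) (spline_in t82) (spline_in t83).
by congr (_, _); field.
Qed.

Lemma tangent_trefoil_inner t : t ^+ 2 <= 81 ->
  tangent trefoil t = ((3 * t ^+ 2 - 49) / 33, 4 * t ^+ 3 - 146 * t).
Proof.
move=> t81; have [t82 t83] : t ^+ 2 <= 82 /\ t ^+ 2 <= 83 by lra.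
rewrite tangent_trefoil /trefoil_dx /trefoil_dy.
rewrite (spline_in t81) (spline_in t82) (spline_in t83).
by rewrite !pos_part_le0 ?subr_le0 //; congr (_, _); field.
Qed.

(** With w = t^2, the second difference (w - 81)^2 - 2 (w - 82)^2 + (w - 83)^2 is 2, which kills the
    second coordinate; and 4 (w - 49) - (w - 81)^2 + (w - 83)^2 is the constant 132. *)
Lemma trefoil_outer t : 83 <= t ^+ 2 -> trefoil t = (t, 0).
Proof.
move=> t83; have [t82 t81] : 82 <= t ^+ 2 /\ 81 <= t ^+ 2 by lra.
rewrite /trefoil /trefoil_x /trefoil_y (spline_out t81) (spline_out t82) (spline_out t83).
by congr (_, _); field.
Qed.

Lemma trefoil_immersion : c1_immersion trefoil.
Proof.
split.
- by move=> t; case: (is_derive_trefoil_x t); case: (is_derive_trefoil_y t).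
- rewrite (_ : derive1 _ = trefoil_dx); first exact: continuous_trefoil_dx.
  by apply/funext => t; have := tangent_trefoil t => -[].
- rewrite (_ : derive1 _ = trefoil_dy); first exact: continuous_trefoil_dy.
  by apply/funext => t; have := tangent_trefoil t => -[].
move=> t; have [t81|t81] := leP (t ^+ 2) 81.
  rewrite tangent_trefoil_inner //; apply/eqP => -[E1 E2].
  have {}E1 : 3 * t ^+ 2 = 49 by lra.
  have : t * (2 * t ^+ 2 - 73) = 0 by lra.
  move/eqP; rewrite mulf_eq0 => /orP[] /eqP E; last by lra.
  by move: E1; rewrite E expr0n /=; lra.
have t81' := ltW t81; rewrite tangent_trefoil; apply/eqP => -[E _]; move: E.
have [t83|t83] := leP (t ^+ 2) 83.
  rewrite /trefoil_dx (spline_in t83) (spline_out t81') pos_part_ge0 ?subr_ge0 //.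
  rewrite pos_part_le0 ?subr_le0 //.
  (* The numerator is concave in t^2, with the positive values 776 and 132 at the nodes 81 and 83;
     this product controls it in between. *)
  have : 0 <= (t ^+ 2 - 81) * (83 - t ^+ 2) by apply: mulr_ge0; lra.
  by move: (t ^+ 2) t81 t83 => w; nra.
have t83' := ltW t83; rewrite /trefoil_dx (spline_out t81') (spline_out t83').
by rewrite !pos_part_ge0 ?subr_ge0 //; move: (t ^+ 2) t83 => w; lra.
Qed.

Lemma trefoil_xN t : trefoil_x (- t) = - trefoil_x t.
Proof. by rewrite /trefoil_x /spline sqrrN; ring. Qed.

Lemma trefoil_x_inner t : t ^+ 2 <= 81 -> trefoil_x t = (t ^+ 3 - 49 * t) / 33.
Proof. by move/trefoil_inner => []. Qed.

(** [trefoil_x u] is u times a function [X] of u^2 that is positive and nondecreasing from 81 on,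
    and constantly 1 from 83 on. *)
Lemma trefoil_x_outer s t : 9 <= s -> s < t -> trefoil_x s < trefoil_x t.
Proof.
pose X w := (4 * (w - 49) - pos_part (w - 81) ^+ 2 + pos_part (w - 83) ^+ 2) / 132.
have Xmid w : 81 <= w -> w <= 83 -> X w = (4 * (w - 49) - (w - 81) ^+ 2) / 132.
  by move=> w1 w3; rewrite /X pos_part_ge0 ?pos_part_le0 ?expr0n ?addr0 //; lra.
have Xtop w : 83 <= w -> X w = 1.
  move=> w3; rewrite /X !pos_part_ge0; [by field|lra|lra].
have X_gt0 w : 81 <= w -> 0 < X w.
  move=> w1; have [w3|w3] := leP w 83; last by rewrite (Xtop w (ltW w3)).
  by rewrite Xmid //; nra.
have X_mono w v : 81 <= w -> w <= v -> X w <= X v.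
  move=> w1 wv; have [v3|v3] := leP v 83; last first.
    rewrite (Xtop v (ltW v3)); have [w3|w3] := leP w 83; last by rewrite (Xtop w (ltW w3)).
    by rewrite Xmid //; have := sqr_ge0 (w - 83); lra.
  rewrite !Xmid //; try lra; rewrite ler_pM2r ?invr_gt0 //.
  have : 0 <= (v - w) * (4 - (v + w - 162)) by apply: mulr_ge0; lra.
  lra.
move=> s9 st; have s2 : 81 <= s ^+ 2 by nra.
have st2 : s ^+ 2 <= t ^+ 2 by nra.
have xE u : trefoil_x u = u * X (u ^+ 2) by rewrite /trefoil_x /X /spline mulrA.
have := X_mono _ _ s2 st2; have := X_gt0 _ s2; rewrite !xE.
by move: (X _) (X _) => A B; nra.
Qed.

Lemma trefoil_x_bound t : t < 9 -> trefoil_x t < trefoil_x 9.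
Proof.
have x9 : trefoil_x 9 = 96 / 11 by rewrite trefoil_x_inner; [field|lra].
move=> t9; have [t9'|t9'] := leP (- 9) t.
  rewrite x9 trefoil_x_inner; last nra.
  (* The product is 33 times the difference of the values at 9 and at [t]; its quadratic factor has
     negative discriminant. *)
  have : 0 < (9 - t) * (t ^+ 2 + 9 * t + 32) by apply: mulr_gt0; nra.
  by rewrite ltr_pdivrMr //; lra.
have := @trefoil_x_outer 9 (- t) (lexx _); rewrite trefoil_xN x9 => H.
by have := H ltac:(lra); lra.
Qed.

Lemma trefoil_meets s t : s < t -> trefoil s = trefoil t ->
  (s, t) \in [:: (-8, 3); (-7, 7); (-3, 8)].
Proof.
move=> st eq; have eqx : trefoil_x s = trefoil_x t by case: eq.
(* From 9 on the first coordinate increases strictly, and before 9 it stays below its value at 9, so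
   no parameter from 9 on belongs to a double point. Oddness settles the other end. *)
have t9 : t < 9.
  rewrite ltNge; apply/negP => t9; have [s9|s9] := leP 9 s.
    by have := trefoil_x_outer s9 st; rewrite eqx ltxx.
  have := trefoil_x_bound s9; rewrite eqx ltNge => /negP; apply.
  by move: t9; rewrite le_eqVlt => /orP[/eqP->//|/(trefoil_x_outer (lexx 9))/ltW].
have s9 : -9 < s.
  rewrite ltNge; apply/negP => s9; have [t9'|t9'] := leP t (-9).
    have := @trefoil_x_outer (- t) (- s); rewrite !trefoil_xN eqx ltxx => H.
    by have := H ltac:(lra) ltac:(lra).
  have := @trefoil_x_bound (- t) ltac:(lra); rewrite trefoil_xN -eqx -trefoil_xN.
  rewrite ltNge => /negP; apply; have : 9 <= - s by lra.
  by rewrite le_eqVlt => /orP[/eqP<-//|/(trefoil_x_outer (lexx 9))/ltW].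
have s2 : s ^+ 2 <= 81 by nra.
have t2 : t ^+ 2 <= 81 by nra.
move: eq; rewrite !trefoil_inner // => -[Ex Ey].
have dst : t - s != 0 by rewrite gt_eqF ?subr_gt0.
(* Both coordinate equations are divided by t - s. *)
have {}Ex : s ^+ 2 + s * t + t ^+ 2 = 49.
  by apply: (mulfI dst); lra.
have : (t + s) * (t ^+ 2 + s ^+ 2 - 73) = 0 by apply: (mulfI dst); lra.
move/eqP; rewrite mulf_eq0 => /orP[] /eqP E.
  have {}E : s = - t by lra.
  have : (t - 7) * (t + 7) = 0 by move: Ex; rewrite E; lra.
  move/eqP; rewrite mulf_eq0 => /orP[] /eqP E'; last lra.
  have -> : t = 7 by lra.
  have -> : s = -7 by lra.
  by rewrite !inE eqxx orbT.
(* Now s^2 + t^2 = 73 and s t = -24, so (t - s)^2 = 121 and (t + s)^2 = 25. *)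
have prod : s * t = - 24 by lra.
have : (t - s - 11) * (t - s + 11) = 0 by lra.
move/eqP; rewrite mulf_eq0 => /orP[] /eqP E'; last lra.
have : (t + s - 5) * (t + s + 5) = 0 by lra.
move/eqP; rewrite mulf_eq0 => /orP[] /eqP E''.
  have -> : t = 8 by lra.
  have -> : s = -3 by lra.
  by rewrite !inE eqxx !orbT.
have -> : t = 3 by lra.
have -> : s = -8 by lra.
by rewrite !inE eqxx.
Qed.

Lemma trefoil_crossing s t : (s, t) \in [:: (-8, 3); (-7, 7); (-3, 8)] ->
  [/\ s < t, trefoil s = trefoil t & det2 (tangent trefoil s) (tangent trefoil t) != 0].
Proof.
rewrite !inE => /or3P[] /eqP[-> ->];
  (rewrite !trefoil_inner ?tangent_trefoil_inner; [|lra..]); (split; first lra).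
all: try (by congr (_, _); field).
all: by apply/eqP; rewrite /det2 /= => E; lra.
Qed.

Lemma trefoil_generic : generic trefoil.
Proof.
have cross s t : self_meets trefoil s t ->
    (s, t) \in [:: (-8, 3); (-7, 7); (-3, 8)] \/ (t, s) \in [:: (-8, 3); (-7, 7); (-3, 8)].
  case=> neq eq; case: (ltrgtP s t) neq => // st _.
    by left; apply: trefoil_meets.
  by right; apply: trefoil_meets.
split.
- move=> s t /cross[] /trefoil_crossing[_ _ //].
  by rewrite -oppr_eq0; congr (_ != 0); rewrite /det2; ring.
(* Each of the six parameters occurs once as a first entry, so it determines its partner and there
   is no triple point. *)
- have partner s t : self_meets trefoil s t -> (s, t) \in
      [:: (-8, 3); (-7, 7); (-3, 8); (3, -8); (7, -7); (8, -3)].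
    by case/cross; rewrite !inE => /or3P[] /eqP[-> ->]; rewrite eqxx ?orbT.
  have functional (L : seq (R * R)) a s t : uniq (map fst L) ->
      (a, s) \in L -> (a, t) \in L -> s = t.
    elim: L => //= -[b u] L IH /andP[bL uL]; rewrite !inE !xpair_eqE.
    have [ab /=|_ /=] := eqVneq a b; last exact: IH.
    have nL w : (a, w) \notin L.
      by apply: contraNN bL => aw; rewrite -ab; apply/mapP; exists (a, w).
    by rewrite !(negbTE (nL _)) !orbF => /eqP-> /eqP->.
  move=> s t w [st eq] /partner tw.
  have /partner ts : self_meets trefoil t s by split; rewrite // eq_sym.
  apply: functional ts tw; apply: lt_sorted_uniq => /=.
  by do !(apply/andP; split) => //; lra.
apply: (@sub_finite_set _ _ [set` [:: (-8, 3); (-7, 7); (-3, 8)] : seq (R * R)]).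
  by move=> [s t] /= [st eq]; apply: trefoil_meets.
exact: finite_seq.
Qed.

End Trefoil.

(** * The extension to singular knots *)

Section SingularExtension.
Variables (R : realType) (f : framing).
Implicit Types (D : diagram R) (d x y : R * R).

Lemma move_invariance D D' : move f D D' -> index_extension f D = index_extension f D'.
Proof.
case=> {}D {}D'.
- exact: isotopic_invariance.
- by move=> -> /kink_invariance; apply=> k ->; rewrite orbT.
- by move=> _; apply: double_kink_invariance.
- by move/bigon_invariance; apply=> k ->; rewrite orbT.
- by move/triangle_invariance; apply=> k l /andP[-> ->]; rewrite orbT.
- by move/kink_invariance; apply=> k ->.
- by move/bigon_invariance; apply=> k ->.
- by move/triangle_invariance; apply=> k l /andP[-> _].
- by move/triangle_invariance; apply=> k l /andP[-> _].
- move/triangle_invariance; apply=> k l /andP[/orP[] -> ->] //.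
  by rewrite !orbT.
- exact: vertex_twist_invariance.
Qed.

Lemma equivalent_invariance D D' :
  equivalent f D D' -> index_extension f D = index_extension f D'.
Proof.
elim=> [E E'|//|E E' _ ->//|E1 E2 E3 _ -> _ ->//]; exact: move_invariance.
Qed.

Lemma resolve_sgn (b : bool) D s t : self_meets D s t ->
  sgn (resolve b D s t) s t = if b then 1 else -1.
Proof.
move=> st; rewrite /sgn /= eqxx.
have := transverse st; rewrite /flat_sign /=.
have -> : det2 (tangent D t) (tangent D s) = - det2 (tangent D s) (tangent D t).
  by rewrite /det2; ring.
have [n|p|->] := ltrgtP (det2 (tangent D s) (tangent D t)) 0; last by [].
  by case: b => _ /=; rewrite ?sgzN ltr0_sgz.
by case: b => _ /=; rewrite ?sgzN gtr0_sgz.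
Qed.

Lemma resolve_mark (b : bool) D d x : x \in dps D -> d \in dps D -> x != d ->
  mark (resolve b D d.1 d.2) x.1 x.2 = mark D x.1 x.2.
Proof.
rewrite !mem_dps => /andP[ltx _] /andP[ltd _] xd /=.
rewrite -!surjective_pairing (negbTE xd); case: eqP => // E.
by move: ltx; rewrite E /= ltNge ltW.
Qed.

Lemma resolve_classical (b : bool) D d :
  classical (mark (resolve b D d.1 d.2) d.1 d.2).
Proof. by rewrite /= eqxx; case: ifP. Qed.

Lemma singular_point_rem D d : singular_points D d ->
  [/\ d \in dps D, perm_eq (dps D) (d :: rem d (dps D)),
      forall x, x \in rem d (dps D) -> x \in dps D /\ x != d
    & num_singular D =
      (count (fun x => singular (mark D x.1 x.2)) (rem d (dps D))).+1].
Proof.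
case=> [[ltd eqd] sd]; have dD : d \in dps D by rewrite mem_dps ltd eqd eqxx.
split=> //; first exact: perm_to_rem.
  by move=> x; rewrite mem_rem_uniq ?fset_uniq // inE => /andP[].
by rewrite singular_dps (permP (perm_to_rem dD)) /= sd.
Qed.

Lemma num_singular_resolve (b : bool) D d : singular_points D d ->
  num_singular D = (num_singular (resolve b D d.1 d.2)).+1.
Proof.
move=> sd; have [dD permD remP ->] := singular_point_rem sd.
rewrite singular_dps (_ : dps (resolve b D d.1 d.2) = dps D) // (permP permD) /=.
rewrite eqxx (_ : singular _ = false); last by case: ifP.
rewrite add0n; congr S; apply: eq_in_count => x /remP[xD xd]; congr (singular _).
exact/esym/resolve_mark.
Qed.

(** Both resolutions give [d] the same charge, its flat sign, so all their indices agree and only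
    the sign of [d] differs. The index of [d] is also that in [D], because [d] does not link
    itself. *)
Lemma skein D d : singular_points D d ->
  index_extension f D = index_extension f (resolve true D d.1 d.2)
                        - index_extension f (resolve false D d.1 d.2).
Proof.
move=> sd; have [dD permD remP nD] := singular_point_rem sd.
have md : self_meets D d.1 d.2 by case: (listing_dps D) => _ + _ _; apply.
pose E b := resolve b D d.1 d.2.
have dpsE b : dps (E b) = dps D by [].
have markE b x : x \in rem d (dps D) -> mark (E b) x.1 x.2 = mark D x.1 x.2.
  by move/remP => [xD xd]; apply: resolve_mark.
have chargeE b x : x \in rem d (dps D) -> charge (E b) x = charge D x.
  by move=> xr; rewrite /charge markE.
have nE b : num_singular D = (num_singular (E b)).+1.
  exact: num_singular_resolve.
have indexE b y : double_index (E b) y =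
    flat_sign D d.1 d.2 * linking d y +
    \sum_(x <- rem d (dps D)) charge D x * linking x y.
  rewrite /double_index dpsE (perm_big _ permD) big_cons; congr (_ * _ + _).
    by rewrite /charge resolve_classical.
  by apply: eq_big_seq => x xr; rewrite chargeE.
have indexD : double_index D d = \sum_(x <- rem d (dps D)) charge D x * linking x d.
  by rewrite /double_index (perm_big _ permD) big_cons /= linkingxx mulr0 add0r.
rewrite /index_extension -/(E true) -/(E false) !dpsE !(perm_big _ permD) !big_cons.
rewrite !(indexE _ d) linkingxx mulr0 add0r indexD.
have [n1 n2] : num_singular (E true) = (num_singular D).-1 /\
    num_singular (E false) = (num_singular D).-1.
  by rewrite (nE true) /=; split=> //; move: (nE false); rewrite (nE true) => -[].
rewrite n1 n2.
have sumE : \sum_(x <- rem d (dps D)) weight (num_singular D).-1 (E true) x *: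
      index_term f `|double_index (E true) x|%N =
    \sum_(x <- rem d (dps D)) weight (num_singular D).-1 (E false) x *:
      index_term f `|double_index (E false) x|%N.
  apply: eq_big_seq => x xr; rewrite !indexE; congr (_ *: _).
  by rewrite /weight /sgn !markE.
rewrite sumE opprD addrACA subrr addr0 -scalerBl.
(* In [D] the other points have no weight: if [d] is the only singular point they are nonsingular,
   and otherwise there are at least two singular points. *)
have sumD : \sum_(x <- rem d (dps D)) weight (num_singular D) D x *:
    index_term f `|double_index D x|%N = 0.
  apply: big1_seq => x /= xr; rewrite nD; have [c0|] := posnP (count
    (fun x => singular (mark D x.1 x.2)) (rem d (dps D))); last first.
    by case: (count _ _) => // n _; rewrite scale0r.
  have /hasPn/(_ _ xr) : ~~ has (fun x => singular (mark D x.1 x.2)) (rem d (dps D)).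
    by rewrite has_count c0.
  by rewrite c0 /weight; case: (mark D x.1 x.2) => //= _; rewrite scale0r.
rewrite [LHS]/= sumD addr0; congr (_ *: _).
have cE b : singular (mark (E b) d.1 d.2) = false.
  by rewrite /= eqxx; case: ifP.
(* The cases count the other singular points. With none, the signs differ by 1 - (-1) = 2; with one,
   the resolutions give weight to that point and not to [d]; with more, all weights vanish. *)
case: sd => _ sD; rewrite nD /weight sD; case: count => [|[|n]]; rewrite ?cE //.
by rewrite !resolve_sgn.
Qed.

Definition trefoil_base : diagram R.
Proof.
apply: (@Diagram R (@trefoil R) (fun _ _ => Virtual) (@trefoil_immersion R) _
  (@trefoil_generic R)); last by [].
by exists 10 => t t10; apply: trefoil_outer; rewrite -real_normK ?num_real //; nra.
Defined.

(* Were all three double points classical or singular, the two signs in each index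
   would cancel; a virtual one leaves a single sign. *)
Definition trefoil_diagram : diagram R :=
  set_mark (set_mark trefoil_base (-8) 3 Singular) (-7) 7 Over.

Lemma trefoil_listing : listing trefoil_diagram [:: (-8, 3); (-7, 7); (-3, 8)].
Proof.
split.
- apply: (@map_uniq _ _ fst); apply: lt_sorted_uniq => /=.
  by do !(apply/andP; split) => //; lra.
- by move=> [s t] /trefoil_crossing[st eq _]; split; rewrite // lt_eqF.
- move=> [s t] /trefoil_crossing[st _ _]; apply/negP => /trefoil_crossing[ts _ _].
  by move: st; rewrite ltNge ltW.
move=> s t [neq eq]; apply/orP; case: (ltrgtP s t) neq => // st _.
  by left; apply: trefoil_meets.
by right; apply: trefoil_meets.
Qed.

Lemma trefoil_mark :
  [/\ mark trefoil_diagram (-8) 3 = Singular, mark trefoil_diagram (-7) 7 = Over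
    & mark trefoil_diagram (-3) 8 = Virtual].
Proof.
have neq (a b c d : R) : a < c \/ c < a -> ((a, b) == (c, d)) = false.
  by move=> ac; apply/eqP => -[E _]; case: ac; rewrite E ltxx.
split=> /=; rewrite ?eqxx //.
  by do 2 (rewrite neq; last lra).
by do 4 (rewrite neq; last lra).
Qed.

Lemma trefoil_singular : singular_points trefoil_diagram (-8, 3).
Proof.
have [mark1 _ _] := trefoil_mark; split=> //.
by have [] := @trefoil_crossing R (-8) 3 (mem_head _ _).
Qed.

Lemma trefoil_num_singular : num_singular trefoil_diagram = 1%N.
Proof.
have [mark1 mark2 mark3] := trefoil_mark.
by rewrite (singular_listing trefoil_listing) /count mark1 mark2 mark3.
Qed.

(** Only the singular point has weight and only the crossing at -7 and 7 has charge. Since -8 < -7 <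
    3 < 7 these two link, so the singular point has index 1 or -1 and the value is 2 (t - 1) or 2
    t. *)
Lemma trefoil_extension : index_extension f trefoil_diagram != 0.
Proof.
have [mark1 mark2 mark3] := trefoil_mark.
rewrite (index_extension_listing f trefoil_listing) trefoil_num_singular.
have w1 : weight 1 trefoil_diagram (-8, 3) = 2 by rewrite /weight mark1.
have w2 : weight 1 trefoil_diagram (-7, 7) = 0 by rewrite /weight mark2.
have w3 : weight 1 trefoil_diagram (-3, 8) = 0 by rewrite /weight mark3.
have c1 : charge trefoil_diagram (-8, 3) = 0 by rewrite /charge mark1.
have c3 : charge trefoil_diagram (-3, 8) = 0 by rewrite /charge mark3.
have c2 : charge trefoil_diagram (-7, 7) =
    flat_sign trefoil_diagram (-7) 7 by rewrite /charge mark2.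
rewrite (eq_bigr (fun y => weight 1 trefoil_diagram y *: index_term f
    (absz (flat_sign trefoil_diagram (-7) 7 * linking (-7, 7) y)))); last first.
  by move=> y _; rewrite !big_cons big_nil c1 c2 c3 !mul0r !addr0 add0r.
rewrite !big_cons big_nil w1 w2 w3 !scale0r !addr0.
have -> : linking (-7 : R, 7) (-8 : R, 3) = -2.
  rewrite /linking /= (ltr0_sgz (_ : - 8 - - 7 < 0 :> R)); last lra.
  rewrite (ltr0_sgz (_ : - 8 - 7 < 0 :> R)); last lra.
  rewrite (gtr0_sgz (_ : 0 < 3 - - 7 :> R)); last lra.
  by rewrite (ltr0_sgz (_ : 3 - 7 < 0 :> R)); last lra.
have meets : self_meets trefoil_diagram (-7) 7.
  by have [_ H _ _] := trefoil_listing; apply: (H (-7, 7)); rewrite !inE eqxx orbT.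
have := sqr_flat_sign meets; set e := flat_sign _ _ _ => e2.
have e1 : absz e = 1%N.
  by apply/eqP; rewrite -(eqn_exp2r _ _ (isT : 0 < 2)%N) -abszX e2.
rewrite abszM e1 mul1n /index_term /=; apply/eqP.
(* The coefficient of t is 2 in both framings. *)
move/(congr1 (fun p : {poly int} => p`_1)).
by case: (f); rewrite coefZ ?coefB coefXn ?coef1 coef0.
Qed.

End SingularExtension.

(** * The index polynomial has order exactly one *)

Theorem proposition5 (R : realType) (f : framing) :
  vassiliev_order_one f (@index_polynomial R f).
Proof.
split.
  exists (index_extension f); first split.
  - exact: equivalent_invariance.
  - exact: index_extension_nonsingular.
  - exact: skein.
  move=> D n1; rewrite /index_extension big1 // => x _.
  by case: (num_singular D) n1 => [|[|n]] // _; rewrite scale0r.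
(* Both resolutions of the trefoil are nonsingular, so the skein relation forces any extension to
   agree there with [index_extension], which does not vanish. *)
case=> nu [_ nu_nonsingular nu_skein] nu0.
have sing := trefoil_singular R.
have resolved b : nonsingular (resolve b (trefoil_diagram R) (-8) 3).
  have := num_singular_resolve b sing; rewrite trefoil_num_singular => -[n0].
  apply: fset_set_set0.
    by apply: sub_finite_set
      (finite_double_points (resolve b (trefoil_diagram R) (-8) 3)) => x [].
  by apply: cardfs0_eq; exact/esym/n0.
have /eqP := trefoil_extension R f; apply.
rewrite (skein f sing) !index_extension_nonsingular //.
rewrite -!nu_nonsingular // -(nu_skein _ (-8, 3)) // nu0 //.
by rewrite trefoil_num_singular.
Qed.
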